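(* The rearrangement group $T_A$ of the Airplane limit space is generated by the five elements $\{\alpha,\beta,\gamma,\delta,\varepsilon\}$ described in the context.
   Context: The Airplane rearrangement group $T_A$. Graphs are finite directed multigraphs with edges coloured red or blue. The base graph $\Gamma$ has vertices $l,a,b,r$, blue edges $e_L:a\to l$ and $e_R:b\to r$, and red edges $e_U:b\to a$ and $e_D:a\to b$. Replacement rules: a red edge from $v_i$ to $v_t$ is replaced by the graph with vertices $v_i,v_t$ and two new vertices $m,w$, with red edges $\mathsf r_1:v_i\to m$, $\mathsf r_2:m\to v_t$ and a blue edge $\mathsf s:m\to w$; a blue edge from $v_i$ to $v_t$ is replaced by the graph with vertices $v_i,v_t$ and two new vertices $x,y$, with blue edges $\mathsf b_-:x\to v_i$, $\mathsf b_+:y\to v_t$ and red edges $\mathsf u:y\to x$, $\mathsf d:x\to y$. An expansion is any graph obtained from $\Gamma$ by finitely many (possibly zero) replacements of single edges. Each edge of an expansion is named by the finite word $e_0e_1\cdots e_k$ recording the edge $e_0$ of $\Gamma$ from which it descends and the successive edges of replacement graphs. Let $\Gamma_0=\Gamma$, and let $\Gamma_{n+1}$ be obtained from $\Gamma_n$ by replacing every edge. Let $\Omega$ be the set of infinite words all of whose finite nonempty prefixes name edges (topologized as a subspace of a product of finite discrete sets). Two such words $e_0e_1\cdots$ and $f_0f_1\cdots$ are equivalent if for every $n$ the edges $e_0\cdots e_n$ and $f_0\cdots f_n$ of $\Gamma_n$ share at least one vertex; this is an equivalence relation, and the Airplane limit space $A$ is the quotient of $\Omega$ by it, with the quotient topology.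 The cell $\chi(e)$ of an edge $e$ is the set of points of $A$ represented by words beginning with $e$. A cellular partition is a cover of $A$ by finitely many cells with pairwise disjoint interiors. If $e,e'$ are edges of the same colour, the canonical homeomorphism $\chi(e)\to\chi(e')$ sends the class of $ew$ to the class of $e'w$. A rearrangement is a homeomorphism $f:A\to A$ for which there is a cellular partition such that $f$ restricts on each of its cells to a canonical homeomorphism onto some cell. Rearrangements form a group $T_A$ under composition. The elements $\alpha,\beta,\gamma,\delta,\varepsilon$. Below, $e\mapsto e'$ means that the element maps $\chi(e)$ onto $\chi(e')$ canonically, and $e\mapsto e'$ (rev), for blue edges, means that it maps $\chi(e)$ onto $\chi(e')$ by the orientation-reversed map sending the classes of $e\mathsf b_\pm w$, $e\mathsf u w$, $e\mathsf d w$ to those of $e'\mathsf b_\mp w$, $e'\mathsf d w$, $e'\mathsf u w$. - $\alpha$: $e_L\mathsf b_+\mapsto e_L$, $e_L\mathsf d\mapsto e_U$, $e_L\mathsf u\mapsto e_D$, $e_L\mathsf b_-\mapsto e_R\mathsf b_-$ (rev), $e_U\mapsto e_R\mathsf u$, $e_D\mapsto e_R\mathsf d$, $e_R\mapsto e_R\mathsf b_+$. - $\beta$: $e_L\mapsto e_U\mathsf s$, $e_U\mapsto e_U\mathsf r_1$, $e_D\mathsf r_1\mapsto e_U\mathsf r_2$, $e_D\mathsf r_2\mapsto e_D$, $e_D\mathsf s\mapsto e_L$, $e_R\mapsto e_R$. - $\gamma$: $e_L\mapsto e_L$, $e_D\mapsto e_D$, $e_R\mapsto e_R$, $e_U\mathsf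 r_1\mapsto e_U\mathsf r_1\mathsf r_1$, $e_U\mathsf s\mapsto e_U\mathsf r_1\mathsf s$, $e_U\mathsf r_2\mathsf r_1\mapsto e_U\mathsf r_1\mathsf r_2$, $e_U\mathsf r_2\mathsf s\mapsto e_U\mathsf s$, $e_U\mathsf r_2\mathsf r_2\mapsto e_U\mathsf r_2$. - $\delta$: $e_L\mapsto e_R$, $e_R\mapsto e_L$, $e_U\mapsto e_D$, $e_D\mapsto e_U$. - $\varepsilon$: $e_L\mapsto e_L$, $e_U\mapsto e_U$, $e_D\mapsto e_D$, $e_R\mathsf b_-\mathsf b_+\mapsto e_R\mathsf b_-$, $e_R\mathsf b_-\mathsf d\mapsto e_R\mathsf u$, $e_R\mathsf b_-\mathsf u\mapsto e_R\mathsf d$, $e_R\mathsf b_-\mathsf b_-\mapsto e_R\mathsf b_+\mathsf b_-$ (rev), $e_R\mathsf u\mapsto e_R\mathsf b_+\mathsf u$, $e_R\mathsf d\mapsto e_R\mathsf b_+\mathsf d$, $e_R\mathsf b_+\mapsto e_R\mathsf b_+\mathsf b_+$. *)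

(* Defs.v *)
From HB Require Import structures.
From mathcomp Require Import all_boot.
From mathcomp Require Import all_classical topology.

Set Implicit Arguments.
Unset Strict Implicit.
Unset Printing Implicit Defensive.

Local Open Scope classical_set_scope.
Local Open Scope quotient_scope.

Variant colour := Red | Blue.

(* Edges of the base graph, followed by those of the red replacement graph
   (r1, r2, s) and of the blue one (b_-, b_+, u, d). *)
Variant letter := eL | eR | eU | eD | r1 | r2 | es | bm | bp | eu | ed.

(* [Vi] and [Vt] are the end points v_i and v_t of the edge being replaced. *)
Variant vname := Vl | Va | Vb | Vr | Vi | Vt | Vm | Vw | Vx | Vy.

Definition letters : seq letter :=
  [:: eL; eR; eU; eD; r1; r2; es; bm; bp; eu; ed].

Definition letter_code (c : letter) : nat :=
  match c with
  | eL => 0 | eR => 1 | eU => 2 | eD => 3 | r1 => 4 | r2 => 5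
  | es => 6 | bm => 7 | bp => 8 | eu => 9 | ed => 10
  end.

Lemma letter_codeK : pcancel letter_code (onth letters).
Proof. by case. Qed.

HB.instance Definition _ := Countable.copy letter (pcan_type letter_codeK).

Lemma letters_enum : Finite.axiom letters.
Proof. by case. Qed.

HB.instance Definition _ := isFinite.Build letter letters_enum.

Definition vname_code (v : vname) : nat :=
  match v with
  | Vl => 0 | Va => 1 | Vb => 2 | Vr => 3 | Vi => 4
  | Vt => 5 | Vm => 6 | Vw => 7 | Vx => 8 | Vy => 9
  end.

Lemma vname_codeK :
  pcancel vname_code (onth [:: Vl; Va; Vb; Vr; Vi; Vt; Vm; Vw; Vx; Vy]).
Proof. by case. Qed.

HB.instance Definition _ := Equality.copy vname (pcan_type vname_codeK).

Definition letter_colour (c : letter) : colour :=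
  match c with
  | eL | eR | es | bm | bp => Blue
  | eU | eD | r1 | r2 | eu | ed => Red
  end.

Definition base_graph : seq letter := [:: eL; eR; eU; eD].

Definition replacement (k : colour) : seq letter :=
  match k with
  | Red => [:: r1; r2; es]
  | Blue => [:: bm; bp; eu; ed]
  end.

Definition letter_ends (c : letter) : vname * vname :=
  match c with
  | eL => (Va, Vl) | eR => (Vb, Vr) | eU => (Vb, Va) | eD => (Va, Vb)
  | r1 => (Vi, Vm) | r2 => (Vm, Vt) | es => (Vm, Vw)
  | bm => (Vx, Vi) | bp => (Vy, Vt) | eu => (Vy, Vx) | ed => (Vx, Vy)
  end.

Notation word := (seq letter).

Definition is_edge (e : word) : bool :=
  if e is c :: e' then
    (c \in base_graph) &&
    path (fun a b => b \in replacement (letter_colour a)) c e'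
  else false.

Definition edge_colour (e : word) : colour := letter_colour (last eL e).

(* [(p, v)] is the vertex created under the name [v] when the edge [p] is
   replaced; the vertices of the base graph have [p = [::]]. *)
Definition vertex := (word * vname)%type.

HB.instance Definition _ := Equality.on vertex.

(* The vertex called [v] in the graph replacing the edge [p], itself an edge
   from [vs.1] to [vs.2]. *)
Definition resolve (p : word) (vs : vertex * vertex) (v : vname) : vertex :=
  match v with Vi => vs.1 | Vt => vs.2 | _ => (p, v) end.

Definition descend (p : word) (vs : vertex * vertex) (c : letter) :=
  (resolve p vs (letter_ends c).1, resolve p vs (letter_ends c).2).

Fixpoint ends_from (p : word) (vs : vertex * vertex) (e : word) :=
  if e is c :: e' then ends_from (rcons p c) (descend p vs c) e' else vs.

(* The initial pair of vertices is arbitrary: no edge of the base graph refers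
   to [Vi] or [Vt]. *)
Definition ends (e : word) : vertex * vertex :=
  ends_from [::] (([::], Va), ([::], Va)) e.

Definition incident (v : vertex) (e : word) : bool :=
  (v == (ends e).1) || (v == (ends e).2).

Definition share_vertex (e f : word) : bool :=
  incident (ends e).1 f || incident (ends e).2 f.

Lemma share_vertexP e f :
  reflect (exists2 v, incident v e & incident v f) (share_vertex e f).
Proof.
apply: (iffP orP) => [[]|[v]].
- by exists (ends e).1 => //; rewrite /incident eqxx.
- by exists (ends e).2 => //; rewrite /incident eqxx orbT.
- by case/orP=> /eqP -> H; [left|right].
Qed.

Lemma share_vertexC e f : share_vertex e f = share_vertex f e.
Proof. by apply/share_vertexP/share_vertexP => -[v ? ?]; exists v. Qed.

Lemma share_vertexx e : share_vertex e e.
Proof. by rewrite /share_vertex /incident eqxx. Qed.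

Lemma ends_rcons e c : ends (rcons e c) = descend e (ends e) c.
Proof.
rewrite /ends -[X in descend X _ _]cat0s.
by elim: e [::] (_, _) => [|a e IH] p vs /=; rewrite ?cats0 ?IH ?cat_rcons.
Qed.

Lemma incident_size e v : e != [::] -> incident v e -> size v.1 < size e.
Proof.
suff H : all (fun v : vertex => size v.1 <= (size e).-1)
             [:: (ends e).1; (ends e).2].
  case: e H => // a e /= /and3P[H1 H2 _] _.
  by case/orP=> /eqP ->; rewrite ltnS.
elim/last_ind: e => [//|e c /= /and3P[H1 H2 _]].
rewrite ends_rcons size_rcons /= andbT.
have R w : size (resolve e (ends e) w).1 <= size e.
  by case: w => //=; [apply: leq_trans H1 _|apply: leq_trans H2 _];
    exact: leq_pred.
by rewrite !R.
Qed.

Lemma incident_rcons e c v :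
  incident v (rcons e c) -> incident v e \/ v.1 = e.
Proof.
rewrite /incident ends_rcons /= => H.
have {H}[w ->] : exists w, v = resolve e (ends e) w.
  by case/orP: H => /eqP ->; eexists.
by case: w => /=; rewrite ?eqxx ?orbT; auto.
Qed.

(* Within a replacement graph, no edge meets both v_i and v_t. *)
Lemma incident_rcons_inj e c v w : e != [::] ->
  incident v e -> incident v (rcons e c) ->
  incident w e -> incident w (rcons e c) -> v = w.
Proof.
move=> e0 ve ve' we we'.
have new u x : incident u e -> (u == (e, x)) = false.
  by move=> ue; apply/eqP => E; have := incident_size e0 ue; rewrite E ltnn.
move: ve' we'; rewrite /incident ends_rcons.
by case: c => /=; rewrite ?(new v, new w) ?orbF //= => /eqP-> /eqP->.
Qed.

Lemma share_rcons e f c d : e != [::] -> size e = size f -> e != f ->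
  share_vertex (rcons e c) (rcons f d) ->
  exists v, [/\ incident v e, incident v f,
                incident v (rcons e c) & incident v (rcons f d)].
Proof.
move=> e0 sz /eqP ef /share_vertexP[v ve' vf']; exists v.
have f0 : f != [::] by rewrite -size_eq0 -sz size_eq0.
have [ve|ve] := incident_rcons ve'; have [vf|vf] := incident_rcons vf'.
- by [].
- by have := incident_size e0 ve; rewrite vf sz ltnn.
- by have := incident_size f0 vf; rewrite ve sz ltnn.
- by case: ef; rewrite -ve -vf.
Qed.

Notation sequences :=
  (prod_topology (fun _ : nat => discrete_topology letter)).

Definition Omega : set sequences :=
  [set x | forall n, is_edge (mkseq (x : nat -> letter) n.+1)].

Definition truncate (x : Omega) (n : nat) : word :=
  mkseq (set_val x : nat -> letter) n.

Definition equivalent (x y : Omega) : bool :=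
  `[< forall n, share_vertex (truncate x n.+1) (truncate y n.+1) >].

Lemma equivalent_is_equiv : equiv_class_of equivalent.
Proof.
split.
- by move=> x; apply/asboolP => n; exact: share_vertexx.
- by move=> x y; apply/asboolP/asboolP => H n; rewrite share_vertexC.
move=> y x z /asboolP xy /asboolP yz; apply/asboolP => n.
have nil0 (w : Omega) : truncate w n.+1 != [::].
  by rewrite -size_eq0 size_mkseq.
have sz (w w' : Omega) : size (truncate w n.+1) = size (truncate w' n.+1).
  by rewrite !size_mkseq.
have next (w : Omega) :
    truncate w n.+2 = rcons (truncate w n.+1) ((set_val w : nat -> letter) n.+1).
  exact: mkseqS.
have [->|nxy] := eqVneq (truncate x n.+1) (truncate y n.+1).
  exact: yz.
have [<-|nyz] := eqVneq (truncate y n.+1) (truncate z n.+1).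
  exact: xy.
have := xy n.+1; rewrite !next.
case/(share_rcons (nil0 _) (sz _ _) nxy) => v [vx vy _ vy'].
have := yz n.+1; rewrite !next.
case/(share_rcons (nil0 _) (sz _ _) nyz) => w [wy wz wy' _].
apply/share_vertexP; exists v => //.
by rewrite (incident_rcons_inj (nil0 y) vy vy' wy wy').
Qed.

Canonical equivalent_equiv := EquivRelPack equivalent_is_equiv.

Definition Airplane := quotient_topology {eq_quot equivalent}.

HB.instance Definition _ := Topological.on Airplane.
HB.instance Definition _ := Quotient.on Airplane.

Definition point_of (x : Omega) : Airplane := \pi_Airplane x.

Definition cell (e : word) : set Airplane :=
  point_of @` [set x : Omega | truncate x (size e) = e].

Definition prepend (e : word) (w : nat -> letter) : sequences :=
  fun n => nth (w (n - size e)) e n.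

(* The class of [ew] goes to that of [e'w]. Since [e] and [e'] are edges of the
   same colour, [ew] is in [Omega] exactly when [e'w] is, so that [f] sends the
   whole cell of [e] onto the cell of [e']. *)
Definition canonical_on (f : Airplane -> Airplane) (e e' : word) : Prop :=
  [/\ is_edge e, is_edge e', edge_colour e = edge_colour e' &
      forall (w : nat -> letter) (x y : Omega),
        set_val x = prepend e w -> set_val y = prepend e' w ->
        f (point_of x) = point_of y].

Definition reversed_on (f : Airplane -> Airplane) (e e' : word) : Prop :=
  [/\ canonical_on f (rcons e bm) (rcons e' bp),
      canonical_on f (rcons e bp) (rcons e' bm),
      canonical_on f (rcons e eu) (rcons e' ed) &
      canonical_on f (rcons e ed) (rcons e' eu)].

Definition cellular_partition (P : seq word) : Prop :=
  [/\ all is_edge P,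
      \bigcup_(e in [set` P]) cell e = [set: Airplane] &
      forall e e', e \in P -> e' \in P -> e != e' ->
        (cell e)° `&` (cell e')° = set0].

Definition homeomorphism (X Y : topologicalType) (f : X -> Y) : Prop :=
  continuous f /\
  exists g : Y -> X, [/\ continuous g, cancel f g & cancel g f].

Definition T_A : set (Airplane -> Airplane) :=
  [set f | homeomorphism f /\
    exists2 P : seq word, cellular_partition P &
      forall e, e \in P -> exists e', canonical_on f e e'].

(* Inverses are required to be two-sided, so [G] is a group of bijections. *)
Definition permutation_group (T : Type) (G : set (T -> T)) : Prop :=
  [/\ G id,
      forall f g, G f -> G g -> G (f \o g) &
      forall f, G f -> exists2 g, G g & cancel f g /\ cancel g f].

Definition generated_group (T : Type) (S : set (T -> T)) : set (T -> T) :=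
  smallest (@permutation_group T) S.

Variant rule := Canonically of word & word | Reversed of word & word.

Definition obeys (f : Airplane -> Airplane) (r : rule) : Prop :=
  match r with
  | Canonically e e' => canonical_on f e e'
  | Reversed e e' => reversed_on f e e'
  end.

Definition acts_by (rs : seq rule) (f : Airplane -> Airplane) : Prop :=
  foldr (fun r P => obeys f r /\ P) True rs.

Definition alpha_rules : seq rule :=
  [:: Canonically [:: eL; bp] [:: eL];
      Canonically [:: eL; ed] [:: eU];
      Canonically [:: eL; eu] [:: eD];
      Reversed [:: eL; bm] [:: eR; bm];
      Canonically [:: eU] [:: eR; eu];
      Canonically [:: eD] [:: eR; ed];
      Canonically [:: eR] [:: eR; bp]].

Definition beta_rules : seq rule :=
  [:: Canonically [:: eL] [:: eU; es];
      Canonically [:: eU] [:: eU; r1];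
      Canonically [:: eD; r1] [:: eU; r2];
      Canonically [:: eD; r2] [:: eD];
      Canonically [:: eD; es] [:: eL];
      Canonically [:: eR] [:: eR]].

Definition gamma_rules : seq rule :=
  [:: Canonically [:: eL] [:: eL];
      Canonically [:: eD] [:: eD];
      Canonically [:: eR] [:: eR];
      Canonically [:: eU; r1] [:: eU; r1; r1];
      Canonically [:: eU; es] [:: eU; r1; es];
      Canonically [:: eU; r2; r1] [:: eU; r1; r2];
      Canonically [:: eU; r2; es] [:: eU; es];
      Canonically [:: eU; r2; r2] [:: eU; r2]].

Definition delta_rules : seq rule :=
  [:: Canonically [:: eL] [:: eR];
      Canonically [:: eR] [:: eL];
      Canonically [:: eU] [:: eD];
      Canonically [:: eD] [:: eU]].

Definition epsilon_rules : seq rule :=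
  [:: Canonically [:: eL] [:: eL];
      Canonically [:: eU] [:: eU];
      Canonically [:: eD] [:: eD];
      Canonically [:: eR; bm; bp] [:: eR; bm];
      Canonically [:: eR; bm; ed] [:: eR; eu];
      Canonically [:: eR; bm; eu] [:: eR; ed];
      Reversed [:: eR; bm; bm] [:: eR; bp; bm];
      Canonically [:: eR; eu] [:: eR; bp; eu];
      Canonically [:: eR; ed] [:: eR; bp; ed];
      Canonically [:: eR; bp] [:: eR; bp; bp]].

(* Main.v *)
Require Import Defs.
From mathcomp Require Import all_boot all_classical topology.
From mathcomp Require Import zify.

Set Implicit Arguments.
Unset Strict Implicit.
Unset Printing Implicit Defensive.

Local Open Scope classical_set_scope.
Local Open Scope quotient_scope.

(** The cells of a subdivision of the Airplane are the edges of a graph made of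
    directed red circles joined by blue edges, in the pattern of a plane tree: every
    vertex that is not a tip is met by one incoming red edge, one outgoing red edge
    and one blue edge. A rearrangement is an isomorphism between two such graphs,
    and a graph of this kind can be read off from any one of its red edges by
    walking along the circles. Hence an isomorphism is determined by the image of
    one red edge, and the group is generated by any elements that bring every
    subdivision, with any chosen red edge, to a normal form.

    A subdivision is encoded by the four trees recording how the edges of the base
    graph are subdivided ([expansion]). Its leaves carry labels, which remember the
    cells of the source, so that a labelled expansion describes a map
    ([describes]). Composing that map with one of the five elements rewrites the
    expansion at its root, without touching the labels: [alpha] moves the centre of
    the picture along a blue edge to the next circle, [beta] turns the central
    circle by one step, [gamma] reassociates the subdivision of a red edge, [delta]
    turns the picture upside down, and [epsilon] shifts the circles strung along a
    blue edge away from the centre. Let [equi] be the equivalence relation generated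
    by these rewritings. Moving the centre around shows that it is compatible with
    the formation of trees, inner parts of blue edges being kept fixed
    ([blue_equi_node], [red_equi_node]), that any red edge can be made the
    upper edge of the centre ([centre]) and that the rest can then be put in normal
    form ([normalise]).

    Let [f] be a rearrangement that is canonical on all cells of some level. Label
    one expansion by the cells of that level at their own places, and another one by
    the same cells at the places of their images. The first describes the identity
    and the second describes [f]. Their normal forms with respect to a common red
    edge describe [g1] and [g2 \o f], with [g1] and [g2] in the group generated by
    the five elements. The incidences between labels are the same in both, because
    both maps are injective, and they determine a normal form
    ([normal_form_unique]). So the normal forms are equal, [g1 = g2 \o f], and [f]
    lies in the group ([T_A_generated]).

    The passage from the limit space to graphs rests on the description of the
    gluing: two different infinite words represent the same point exactly when they
    converge to the same vertex ([pt_eq]). It shows that vertices and points at the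
    ends of cells are the same thing ([end_pt_eq]), that rules respecting
    incidences define homeomorphisms ([rules_T_A]), among them the five elements,
    and, through words that converge to no vertex, that a cell is known from its
    points ([cell_prefix]), which makes [T_A] a group ([T_A_group]). *)

(** * Edges and their end points *)

Definition grows (k : colour) : pred letter := fun b => b \in replacement k.

Lemma is_edge_nil e : is_edge e -> e != [::].
Proof. by case: e. Qed.

Lemma is_edge_cat e s : e != [::] ->
  is_edge (e ++ s) =
  is_edge e && path (fun a => grows (letter_colour a)) (last eL e) s.
Proof. by case: e => // c e _ /=; rewrite cat_path andbA. Qed.

Lemma is_edge_rcons e c : e != [::] ->
  is_edge (rcons e c) = is_edge e && grows (edge_colour e) c.
Proof. by move=> e0; rewrite -cats1 is_edge_cat //= andbT. Qed.

Lemma edge_colour_rcons e c : edge_colour (rcons e c) = letter_colour c.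
Proof. by rewrite /edge_colour last_rcons. Qed.

Lemma is_edge_prefix e s : e != [::] -> is_edge (e ++ s) -> is_edge e.
Proof. by move=> e0; rewrite is_edge_cat // => /andP[]. Qed.

Lemma growing_path_colour c c' s : letter_colour c = letter_colour c' ->
  path (fun a => grows (letter_colour a)) c s =
  path (fun a => grows (letter_colour a)) c' s.
Proof. by case: s => //= d s ->. Qed.

Lemma is_edge_recolour e e' s : is_edge e -> is_edge e' ->
  edge_colour e = edge_colour e' -> is_edge (e ++ s) = is_edge (e' ++ s).
Proof.
move=> ee ee' C; rewrite !is_edge_cat ?is_edge_nil // ee ee' /=.
exact: growing_path_colour.
Qed.

Lemma edge_colour_cat e e' s : edge_colour e = edge_colour e' ->
  edge_colour (e ++ s) = edge_colour (e' ++ s).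
Proof. by rewrite /edge_colour !last_cat; case: s. Qed.

(** Ends are indexed by booleans, so that reversing an edge negates the index. *)
Definition side (e : word) (b : bool) : vertex :=
  if b then (ends e).2 else (ends e).1.

Lemma incidentP v e : reflect (exists b, v = side e b) (incident v e).
Proof.
apply: (iffP orP) => [[/eqP|/eqP]->|[[] ->]]; rewrite ?eqxx; auto.
- by exists false.
- by exists true.
Qed.

Lemma incident_side e b : incident (side e b) e.
Proof. by apply/incidentP; exists b. Qed.

Lemma side_rcons e c b :
  side (rcons e c) b =
  resolve e (ends e) (if b then (letter_ends c).2 else (letter_ends c).1).
Proof. by rewrite /side ends_rcons; case: b. Qed.

Lemma resolve_cases n :
  (exists k, forall e, resolve e (ends e) n = side e k) \/
  (forall e, resolve e (ends e) n = (e, n)).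
Proof. by case: n; auto; left; [exists false|exists true]. Qed.

Lemma size_side e b : e != [::] -> size (side e b).1 < size e.
Proof. by move=> e0; apply: incident_size (incident_side _ _). Qed.

Lemma side_new e b n : e != [::] -> side e b <> (e, n).
Proof. by move=> e0 E; have := size_side b e0; rewrite E ltnn. Qed.

Lemma side_neq e : e != [::] -> side e false <> side e true.
Proof.
case/lastP: e => // e c _; rewrite !side_rcons.
have [->|e0] := eqVneq e [::]; first by case: c.
case: c => //=; [|move/esym|move/esym|move/esym].
- exact: (@side_new e false).
- exact: (@side_new e true).
- exact: (@side_new e false).
- exact: (@side_new e true).
Qed.

(** Only blue edges reach the tips of the figure: a vertex that a new red edge
    meets is either an old one or the attaching point of a blue edge. *)
Definition tip_name (n : vname) := n \in [:: Vl; Vr; Vw].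

Lemma red_side_not_tip e b : is_edge e -> edge_colour e = Red ->
  ~~ tip_name (side e b).2.
Proof.
elim/last_ind: e b => // e c IH b.
have [->|e0] := eqVneq e [::]; first by case: c b => [] [].
rewrite is_edge_rcons // edge_colour_rcons => /andP[ee] + C.
rewrite /grows; case E: (edge_colour e).
  have H k := IH k ee E.
  rewrite !inE => /or3P[] /eqP cE; move: C; rewrite cE // => _; rewrite side_rcons;
    by case: b => //=; first [exact: (H false) | exact: (H true)].
by move=> H; move: C H; case: c => // _ _; rewrite side_rcons; case: b.
Qed.

Lemma incident_prefix v e : incident v e -> prefix v.1 e.
Proof.
elim/last_ind: e => [|e c IH]; first by case/orP=> /eqP->.
by case/incident_rcons => [/IH|->]; [move/prefix_trans; apply|];
  exact: prefix_rcons.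
Qed.

Lemma incident_down v e s :
  size v.1 < size e -> incident v (e ++ s) -> incident v e.
Proof.
move=> lt; elim/last_ind: s => [|s c IH]; first by rewrite cats0.
rewrite -rcons_cat => /incident_rcons[//|E].
by move: lt; rewrite E size_cat ltnNge leq_addr.
Qed.

(** A vertex met by an edge below [w] is either an end of [w] or created inside the
    cell, and then named relatively to it; so it has a counterpart below [w']. *)
Lemma side_cat w w' a b :
  (exists k, side (w ++ a) b = side w k /\ side (w' ++ a) b = side w' k) \/
  (exists p n, side (w ++ a) b = (w ++ p, n) /\
               side (w' ++ a) b = (w' ++ p, n)).
Proof.
elim/last_ind: a b => [|a c IH] b; first by left; exists b; rewrite !cats0.
rewrite -!rcons_cat !side_rcons.
have [[k E]|E] := resolve_cases
  (if b then (letter_ends c).2 else (letter_ends c).1); rewrite !E; first exact: IH.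
by right; exists a, (if b then (letter_ends c).2 else (letter_ends c).1).
Qed.

Lemma incident_transfer w w' a p n : w != [::] ->
  incident (w ++ p, n) (w ++ a) -> incident (w' ++ p, n) (w' ++ a).
Proof.
move=> w0 /incidentP[b E]; apply/incidentP; exists b.
have [[k [E1 _]]|[q [m [E1 ->]]]] := side_cat w w' a b.
  by have := size_side k w0; rewrite -E1 -E size_cat ltnNge leq_addr.
by move: E; rewrite E1 => -[/eqP]; rewrite eqseq_cat // => /andP[_ /eqP->] ->.
Qed.

(** * Infinite words and the vertices they converge to *)

(** The tail of the infinite word that stays at an end point of a cell. The inner
    edge [bm] of a blue edge points towards its initial vertex, hence the exceptional
    first letter. *)
Definition ray (k : colour) (b : bool) (n : nat) : letter :=
  match k, b with
  | Red, false => r1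
  | Red, true => r2
  | Blue, false => if n is 0 then bm else bp
  | Blue, true => bp
  end.

Lemma mkseqD T (x : nat -> T) m n :
  mkseq x (m + n) = mkseq x m ++ mkseq (fun i => x (m + i)) n.
Proof.
rewrite /mkseq iotaD map_cat add0n -[X in iota X n]addn0 iotaDl -map_comp.
by congr (_ ++ _); apply: eq_map => i /=; rewrite addn0.
Qed.

(** The end at which a ray stays after its first letter. *)
Definition turned (k : colour) (b : bool) : bool := if k is Red then b else true.

Lemma rayS k b n : ray k b n.+1 = ray k (turned k b) n.
Proof. by case: k b => [] []. Qed.

Lemma ray0_grows k b : grows k (ray k b 0).
Proof. by case: k b => [] []. Qed.

Lemma ray0_colour k b : letter_colour (ray k b 0) = k.
Proof. by case: k b => [] []. Qed.

Lemma side_ray0 e k b : side (rcons e (ray k b 0)) (turned k b) = side e b.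
Proof. by rewrite side_rcons; case: k b => [] []. Qed.

Lemma mkseqSl T (x : nat -> T) n :
  mkseq x n.+1 = x 0 :: mkseq (fun i => x i.+1) n.
Proof. by rewrite -add1n mkseqD. Qed.

Lemma side_ray e k b n :
  side (e ++ mkseq (ray k b) n) (if n is 0 then b else turned k b) = side e b.
Proof.
elim: n e b => [|n IH] e b; first by rewrite cats0.
rewrite mkseqSl -cat_rcons (eq_mkseq (rayS k b)) -(side_ray0 e k b).
by rewrite -[RHS]IH; case: n {IH} => //; case: k.
Qed.

Lemma is_edge_ray e b n : is_edge e ->
  is_edge (e ++ mkseq (ray (edge_colour e) b) n).
Proof.
elim: n e b => [|n IH] e b ee; first by rewrite cats0.
rewrite mkseqSl -cat_rcons (eq_mkseq (rayS _ b)).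
have C : edge_colour (rcons e (ray (edge_colour e) b 0)) = edge_colour e.
  by rewrite edge_colour_rcons ray0_colour.
have := IH (rcons e (ray (edge_colour e) b 0)) (turned (edge_colour e) b).
by rewrite C; apply; rewrite is_edge_rcons ?is_edge_nil // ee ray0_grows.
Qed.

Lemma ray_unique0 e c b : e != [::] -> is_edge (rcons e c) ->
  incident (side e b) (rcons e c) -> c = ray (edge_colour e) b 0.
Proof.
move=> e0; rewrite is_edge_rcons // => /andP[_ gr] /incidentP[b'].
have N n : side e b <> (e, n) by exact: side_new.
have D : side e b <> side e (~~ b).
  by case: b {N} => // E; apply: (side_neq e0).
rewrite side_rcons.
by case: (edge_colour e) gr; case: c => // _;
  case: b b' N D => [] [] /= N D // E; first [case: (N _ E) | case: (D E)].
Qed.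

(** At each level below a cell, exactly one edge meets a given end of it. *)
Lemma ray_unique e b s : is_edge e ->
  (forall n, is_edge (e ++ mkseq s n)) ->
  (forall n, incident (side e b) (e ++ mkseq s n)) ->
  s = ray (edge_colour e) b.
Proof.
move=> ee es is_; apply/funext => n.
elim: n e b s ee es is_ => [|n IH] e b s ee es is_.
  apply: ray_unique0; rewrite ?is_edge_nil // -cats1.
  - exact: es 1.
  - exact: is_ 1.
have E m : e ++ mkseq s m.+1 = rcons e (s 0) ++ mkseq (fun i => s i.+1) m.
  by rewrite mkseqSl cat_rcons.
have s0 : s 0 = ray (edge_colour e) b 0.
  apply: ray_unique0; rewrite ?is_edge_nil // -cats1.
  - exact: es 1.
  - exact: is_ 1.
have es0 : is_edge (rcons e (s 0)) by have := es 1; rewrite E cats0.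
have := IH (rcons e (s 0)) (turned (edge_colour e) b) (fun i => s i.+1) es0.
rewrite edge_colour_rcons s0 ray0_colour rayS; apply=> m; rewrite -s0 -E //.
by rewrite s0 side_ray0.
Qed.

(** A vertex becomes a point of the limit space, the class of the words that
    converge to it in this sense. *)
Definition limit (x : nat -> letter) (v : vertex) : Prop :=
  exists N, forall n, N <= n -> incident v (mkseq x n).

Lemma mkseq_nil (x : nat -> letter) n : (mkseq x n == [::]) = (n == 0).
Proof. by rewrite -size_eq0 size_mkseq. Qed.

Lemma limit_unique x v w : limit x v -> limit x w -> v = w.
Proof.
move=> [M HM] [N HN]; pose n := (maxn M N).+1.
have Mn : M <= n by rewrite leqW ?leq_maxl.
have Nn : N <= n by rewrite leqW ?leq_maxr.
apply: (@incident_rcons_inj (mkseq x n) (x n)).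
- by rewrite mkseq_nil.
- exact: HM.
- by rewrite -mkseqS; apply: HM; exact: leqW.
- exact: HN.
- by rewrite -mkseqS; apply: HN; exact: leqW.
Qed.

Lemma limit_incident x v n : limit x v -> size v.1 < n -> incident v (mkseq x n).
Proof.
move=> [N H] lt; have := H (n + N) (leq_addl _ _).
by rewrite mkseqD => /incident_down; apply; rewrite size_mkseq.
Qed.

Lemma limit_prefix x v : limit x v -> v.1 = mkseq x (size v.1).
Proof.
move=> xv; have := incident_prefix (limit_incident xv (leqnn _)).
by rewrite prefixE => /eqP{1}<-; rewrite -addn1 mkseqD take_cat size_mkseq ltnn
  subnn take0 cats0.
Qed.

(** Below the edge at which [v] is created the two words meet [v]; above it they
    agree, since both pass through that edge. *)
Lemma limit_share x y v n : limit x v -> limit y v ->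
  share_vertex (mkseq x n) (mkseq y n).
Proof.
move=> xv yv; case: (leqP n (size v.1)) => [le|lt].
  suff -> : mkseq x n = mkseq y n by exact: share_vertexx.
  have E : mkseq x (size v.1) = mkseq y (size v.1) by rewrite -!limit_prefix.
  by move/(congr1 (take n)): E; rewrite /mkseq -!map_take take_iota (minn_idPl le).
by apply/share_vertexP; exists v; exact: limit_incident.
Qed.

(** After the two words have separated, a vertex shared at one level is shared at
    the next one too: a new vertex lies on the replacements of one edge only, and an
    edge of a replacement graph meets at most one of the old vertices. *)
Lemma share_limit x y : (forall n, share_vertex (mkseq x n.+1) (mkseq y n.+1)) ->
  x <> y -> exists v, limit x v /\ limit y v.
Proof.
move=> sh xy.
have [m xym] : exists m, x m <> y m.
  by apply/existsNP => E; apply: xy; apply/funext.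
have D n : m < n -> mkseq x n != mkseq y n.
  move=> lt; apply/eqP => /(congr1 (nth eL ^~ m)).
  by rewrite !nth_mkseq.
have step n : m < n -> exists v, [/\ incident v (mkseq x n),
    incident v (mkseq y n), incident v (mkseq x n.+1) & incident v (mkseq y n.+1)].
  move=> lt; have := sh n; rewrite !mkseqS; apply: share_rcons.
  - by rewrite mkseq_nil -lt0n (leq_ltn_trans _ lt).
  - by rewrite !size_mkseq.
  - exact: D.
have [v [vx vy vx' vy']] := step m.+1 (leqnn _).
suff H n : m < n -> [/\ incident v (mkseq x n), incident v (mkseq y n),
    incident v (mkseq x n.+1) & incident v (mkseq y n.+1)].
  by exists v; split; exists m.+1 => n /H[].
elim: n => // n IH; rewrite ltnS leq_eqVlt => /predU1P[<-//|lt].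
have [vxn vyn vxn' vyn'] := IH lt.
have [w [wx wy wx' wy']] := step n.+1 (leqW lt).
suff E : w = v by rewrite E in wx' wy'.
have n0 (z : nat -> letter) : mkseq z n != [::].
  by rewrite mkseq_nil -lt0n (leq_ltn_trans _ lt).
have sz (z : nat -> letter) : incident w (mkseq z n) -> size w.1 < n.
  by move=> /(incident_size (n0 _)); rewrite size_mkseq.
rewrite !mkseqS in wx wy vxn' vyn'.
have wxn : incident w (mkseq x n).
  have [//|wx1] := incident_rcons wx; have [/sz|wy1] := incident_rcons wy.
    by rewrite wx1 size_mkseq ltnn.
  by have := D n lt; rewrite -wx1 wy1 eqxx.
exact: incident_rcons_inj (n0 x) wxn wx vxn vxn'.
Qed.

Lemma prepend_cat e s w : prepend (e ++ s) w = prepend e (prepend s w).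
Proof.
apply/funext => n; rewrite /prepend size_cat subnDA nth_cat; case: ltnP => // le.
- exact: set_nth_default.
- by rewrite [RHS]nth_default.
Qed.

Lemma mkseq_prepend e w n :
  mkseq (prepend e w : nat -> letter) (size e + n) = e ++ mkseq w n.
Proof.
rewrite mkseqD; congr (_ ++ _).
  apply: (@eq_from_nth _ eL) => [|i]; rewrite size_mkseq // => lt.
  by rewrite nth_mkseq // /prepend; exact: set_nth_default.
by apply: eq_mkseq => i; rewrite /prepend nth_default ?leq_addr // addKn.
Qed.

Lemma mkseq_prepend0 e w : mkseq (prepend e w : nat -> letter) (size e) = e.
Proof. by rewrite -[X in mkseq _ X]addn0 mkseq_prepend cats0. Qed.

Lemma prepend_mkseq (x : nat -> letter) n :
  x = prepend (mkseq x n) (fun i => x (n + i)).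
Proof.
apply/funext => i; rewrite /prepend size_mkseq; case: (ltnP i n) => [lt|le].
  by rewrite nth_mkseq.
by rewrite nth_default ?size_mkseq // subnKC.
Qed.

Lemma prepend_inj e w w' : prepend e w = prepend e w' -> w = w'.
Proof.
move=> E; apply/funext => i.
have := congr1 (fun f : sequences => f (size e + i)) E.
by rewrite /prepend !nth_default ?leq_addr // addKn.
Qed.

Lemma Omega_prepend e w : is_edge e ->
  Omega (prepend e w) <-> forall n, is_edge (e ++ mkseq w n).
Proof.
move=> ee; have lt0 : 0 < size e by case: e ee.
split=> H n.
  by have := H (size e + n).-1; rewrite prednK ?addn_gt0 ?lt0 // mkseq_prepend.
have := H n.+1; rewrite -mkseq_prepend addnC mkseqD.
by apply: is_edge_prefix; rewrite mkseq_nil.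
Qed.

Lemma Omega_recolour e e' w : is_edge e -> is_edge e' ->
  edge_colour e = edge_colour e' -> Omega (prepend e w) -> Omega (prepend e' w).
Proof.
move=> ee ee' C /(Omega_prepend w ee) H; apply/(Omega_prepend w ee') => n.
by rewrite -(is_edge_recolour _ ee ee' C).
Qed.

Lemma Omega_edge x n : Omega x -> 0 < n -> is_edge (mkseq x n).
Proof. by move=> + /prednK <-; apply. Qed.

Lemma Omega_ray e b : is_edge e -> Omega (prepend e (ray (edge_colour e) b)).
Proof. by move=> ee; apply/Omega_prepend => // n; exact: is_edge_ray. Qed.

(** Made total with a dummy value, to speak of the point of an infinite word
    without carrying a proof of membership in [Omega]. *)
Definition pt (x : sequences) : Airplane :=
  if pselect (Omega x) is left Ox then point_of (SigSub (mem_set Ox))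
  else point_of (SigSub (mem_set (@Omega_ray [:: eU] false isT))).

Lemma point_of_pt (x : Omega) : point_of x = pt (set_val x).
Proof.
rewrite /pt; case: pselect => [Ox|[]]; last exact: set_valP.
by congr point_of; exact: val_inj.
Qed.

Lemma ptE x (Ox : Omega x) : pt x = point_of (SigSub (mem_set Ox)).
Proof. by rewrite point_of_pt. Qed.

Lemma pt_surj (p : Airplane) : exists2 x, Omega x & p = pt x.
Proof.
exists (set_val (repr p : Omega)); first exact: set_valP.
by rewrite -point_of_pt /point_of reprK.
Qed.

(** The gluing identifies only words that converge to a common vertex. *)
Lemma pt_eq x y : Omega x -> Omega y ->
  pt x = pt y <-> x = y \/ exists v, limit x v /\ limit y v.
Proof.
move=> Ox Oy; rewrite (ptE Ox) (ptE Oy) /point_of; split.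
  move=> /eqmodP /asboolP sh.
  by have [->|/eqP xy] := eqVneq x y; [left|right; exact: share_limit xy].
case=> [E|[v [xv yv]]]; apply/eqmodP/asboolP => n.
- by move: Oy; case: _ / E => Oy; exact: share_vertexx.
- exact: limit_share xv yv.
Qed.

Lemma limit_ray e b : is_edge e ->
  limit (prepend e (ray (edge_colour e) b)) (side e b).
Proof.
move=> ee; exists (size e) => n /subnKC <-; rewrite mkseq_prepend.
rewrite -(side_ray e (edge_colour e) b (n - size e)); exact: incident_side.
Qed.

(** The point that the vertex [side e b] becomes. *)
Definition end_pt (e : word) (b : bool) : Airplane :=
  pt (prepend e (ray (edge_colour e) b)).

Lemma end_pt_eq e e' b b' : is_edge e -> is_edge e' ->
  end_pt e b = end_pt e' b' <-> side e b = side e' b'.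
Proof.
move=> ee ee'; rewrite /end_pt pt_eq; try exact: Omega_ray.
have le := limit_ray b ee; have le' := limit_ray b' ee'.
split=> [[E|[v [xv yv]]]|E].
- by rewrite E in le; exact: limit_unique le le'.
- by rewrite (limit_unique le xv) (limit_unique le' yv).
- by right; exists (side e b); rewrite {2}E.
Qed.

(** ** Words that represent no vertex *)

(** A generic word is alone in its class, so that the cells containing its point are
    exactly those named by its prefixes. *)
Definition generic (x : nat -> letter) : Prop := Omega x /\ forall v, ~ limit x v.

Lemma pt_generic x y : generic x -> Omega y -> pt x = pt y -> x = y.
Proof.
by move=> [Ox nx] Oy /(pt_eq Ox Oy)[|[v [/nx]]].
Qed.

Definition alternate (n : nat) : letter := if odd n then r2 else r1.

(* Halving a red edge alternately from both sides leaves its two ends. *)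
Lemma generic_red e : is_edge e -> edge_colour e = Red ->
  generic (prepend e alternate).
Proof.
move=> ee C; split.
  apply/Omega_prepend => // n.
  suff H : is_edge (e ++ mkseq alternate n) /\
      edge_colour (e ++ mkseq alternate n) = Red by case: H.
  elim: n => [|n [IH1 IH2]]; first by rewrite cats0.
  rewrite mkseqS -rcons_cat is_edge_rcons; last first.
    by apply/eqP => /(congr1 size); case: (e) ee.
  by rewrite IH1 IH2 edge_colour_rcons /alternate; case: odd.
move=> v xv; pose n := (size v.1).*2.
have lt : size v.1 <= n by rewrite /n -addnn leq_addr.
pose g := e ++ mkseq alternate n.
have g0 : g != [::] by rewrite /g; case: (e) ee.
have inc m : incident v (e ++ mkseq alternate (n + m)).
  rewrite -mkseq_prepend; apply: limit_incident => //.
  have : 0 < size e by case: (e) ee.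
  by move=> ?; rewrite -addn1 addnC leq_add // (leq_trans lt) // leq_addr.
have := inc 2; rewrite addn2 !mkseqS -!rcons_cat /alternate /=.
rewrite /n odd_double /= -/n -/g.
have sz : size v.1 < size g.
  by rewrite size_cat size_mkseq -addn1 addnC leq_add //; case: (e) ee.
move=> /incidentP[b E]; move: sz.
have : v = (rcons g r1, Vm) \/ v = (g, Vm).
  by rewrite E side_rcons; case: (b) => /=; [right; rewrite ends_rcons | left].
by case=> ->; rewrite ?size_rcons ltnNge ?leqnSn ?leqnn.
Qed.

Lemma generic_edge e : is_edge e -> exists w, generic (prepend e w).
Proof.
move=> ee; case C : (edge_colour e); first by exists alternate; exact: generic_red.
exists (prepend [:: eu] alternate); rewrite -prepend_cat cats1.
by apply: generic_red; rewrite ?edge_colour_rcons // is_edge_rcons ?is_edge_nil // ee C.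
Qed.


(** * Canonical maps between cells *)

Lemma canonicalP (f : Airplane -> Airplane) e e' :
  canonical_on f e e' <->
  [/\ is_edge e, is_edge e', edge_colour e = edge_colour e' &
      forall w, Omega (prepend e w) -> f (pt (prepend e w)) = pt (prepend e' w)].
Proof.
split=> -[ee ee' C H]; split=> // w.
- move=> Ow; have Ow' := Omega_recolour ee ee' C Ow.
  by rewrite (ptE Ow) (ptE Ow'); exact: H.
- move=> x y xE yE; rewrite !point_of_pt xE yE; apply: H.
  by rewrite -xE; exact: set_valP.
Qed.

Lemma canonical_id e : is_edge e -> canonical_on id e e.
Proof. by move=> ee; apply/canonicalP. Qed.

Lemma canonical_comp (f g : Airplane -> Airplane) e e' e'' :
  canonical_on f e e' -> canonical_on g e' e'' -> canonical_on (g \o f) e e''.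
Proof.
move=> /canonicalP[ee ee' C H] /canonicalP[_ ee'' C' H'].
apply/canonicalP; split; rewrite ?C // => w Ow /=.
by rewrite H // H' //; exact: Omega_recolour Ow.
Qed.

Lemma canonical_inv (f g : Airplane -> Airplane) e e' :
  cancel f g -> canonical_on f e e' -> canonical_on g e' e.
Proof.
move=> fK /canonicalP[ee ee' C H]; apply/canonicalP; split=> // w Ow.
by rewrite -H ?fK //; apply: Omega_recolour Ow.
Qed.

Lemma canonical_cat f e e' s : is_edge (e ++ s) ->
  canonical_on f e e' -> canonical_on f (e ++ s) (e' ++ s).
Proof.
move=> ees /canonicalP[ee ee' C H]; apply/canonicalP; split=> //.
- by rewrite -(is_edge_recolour _ ee ee' C).
- exact: edge_colour_cat.
- by move=> w Ow; rewrite !prepend_cat H -?prepend_cat.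
Qed.

Lemma canonical_rcons f e e' c : grows (edge_colour e) c ->
  canonical_on f e e' -> canonical_on f (rcons e c) (rcons e' c).
Proof.
move=> gr H; rewrite -!cats1; apply: canonical_cat => //.
by rewrite cats1; case: H => ee _ _ _; rewrite is_edge_rcons ?is_edge_nil ?ee.
Qed.

Lemma prepend_rcons e c w : prepend (rcons e c) w = prepend e (prepend [:: c] w).
Proof. by rewrite -cats1 prepend_cat. Qed.

Lemma prepend1 (w : nat -> letter) : prepend [:: w 0] (fun n => w n.+1) = w.
Proof. by apply/funext => -[|[|n]]. Qed.

(** Every word in the cell of [e] continues with an edge of the replacement graph,
    so it is enough to look at the parts of the cell. *)
Lemma canonical_glue f e e' : is_edge e -> is_edge e' ->
  edge_colour e = edge_colour e' ->
  (forall c, grows (edge_colour e) c -> canonical_on f (rcons e c) (rcons e' c)) ->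
  canonical_on f e e'.
Proof.
move=> ee ee' C H; apply/canonicalP; split=> // w Ow.
have gr : grows (edge_colour e) (w 0).
  have /(_ 1) := (Omega_prepend w ee).1 Ow.
  by rewrite cats1 is_edge_rcons ?is_edge_nil // => /andP[].
have /canonicalP[_ _ _] := H _ gr.
by move=> /(_ (fun n => w n.+1)); rewrite !prepend_rcons prepend1; apply.
Qed.

Lemma canonical_end_pt f e e' b : canonical_on f e e' ->
  f (end_pt e b) = end_pt e' b.
Proof.
move=> /canonicalP[ee ee' C H]; rewrite /end_pt H ?C //.
by rewrite -C; exact: Omega_ray.
Qed.

(** * Topology of the limit space *)

Lemma eq_mkseq_le (x y : nat -> letter) m n : m <= n ->
  mkseq x n = mkseq y n -> mkseq x m = mkseq y m.
Proof.
move=> le /(congr1 (take m)).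
by rewrite /mkseq -!map_take take_iota (minn_idPl le).
Qed.

Lemma eq_mkseq_nth (x y : nat -> letter) i n : i < n ->
  mkseq x n = mkseq y n -> x i = y i.
Proof. by move=> lt /(congr1 (nth eL ^~ i)); rewrite !nth_mkseq. Qed.

(** A neighbourhood constrains finitely many letters only. *)
Lemma nbhs_sequencesP (x : sequences) (U : set sequences) :
  nbhs x U <-> exists n, forall y : sequences,
    mkseq (y : nat -> letter) n = mkseq (x : nat -> letter) n -> U y.
Proof.
pose F : set_system sequences := [set U | exists n, forall y : sequences,
    mkseq (y : nat -> letter) n = mkseq (x : nat -> letter) n -> U y].
have FF : Filter F.
  split; first by exists 0.
  - move=> A B [m Am] [n Bn]; exists (maxn m n) => y E.
    by split; [apply: Am | apply: Bn]; apply: eq_mkseq_le E;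
      rewrite ?leq_maxl ?leq_maxr.
  - by move=> A B AB [n An]; exists n => y /An /AB.
have Fx : F --> x.
  apply/cvg_sup => i A [B [[C oC <-] Cx] BA].
  exists i.+1 => y E; apply: BA.
  by rewrite /preimage /= (eq_mkseq_nth (ltnSn i) E).
split; first exact: Fx.
move=> [n Un].
suff H m : nbhs x [set y : sequences | mkseq (y : nat -> letter) m =
                           mkseq (x : nat -> letter) m].
  by apply: filterS (H n) => y /Un.
elim: m => [|m IH]; first by apply: filterS filterT => y _.
have Hm : nbhs x [set y : sequences | y m = x m].
  have := @proj_continuous nat (fun=> discrete_topology letter) m x.
  by move/(_ [set x m]); apply; exact: discrete_set1.
apply: filterS (filterI IH Hm) => y [/= E Em].
by rewrite !mkseqS E Em.
Qed.

Lemma open_OmegaP (U : set Omega) :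
  open U <-> forall x : Omega, U x -> exists n, forall y : Omega,
    truncate y n = truncate x n -> U y.
Proof.
split.
  move=> [V oV <-] x Vx.
  have /nbhs_sequencesP[n Vn] : nbhs (set_val x) V by exact: open_nbhs_nbhs.
  by exists n => y /Vn.
move=> H; rewrite openE => x /H[n Un].
exists (set_val @^-1` [set y : sequences | mkseq (y : nat -> letter) n =
                           mkseq (set_val x : nat -> letter) n]).
split=> /=; [|by []|exact: Un].
exists [set y : sequences | mkseq (y : nat -> letter) n =
                           mkseq (set_val x : nat -> letter) n] => //.
rewrite openE => y /= E; apply/nbhs_sequencesP; exists n => z /=.
by rewrite E.
Qed.

(** In a quotient of a product of discrete spaces, continuity may be tested on
    infinite words, where it says that each letter of the image depends on finitely
    many letters. *)
Lemma continuous_pt (f : Airplane -> Airplane) :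
  (forall x, Omega x -> exists y, [/\ Omega y, f (pt x) = pt y &
     forall n, exists m, forall x', Omega x' -> mkseq (x' : nat -> letter) m =
        mkseq (x : nat -> letter) m ->
        exists y', [/\ Omega y', f (pt x') = pt y' & mkseq (y' : nat -> letter) n =
            mkseq (y : nat -> letter) n]]) ->
  continuous f.
Proof.
move=> H; apply/continuousP => A oA.
rewrite /open /= /quotient_open.
apply/open_OmegaP => x Ax.
have [y [Oy fxy Hn]] := H _ (set_valP x).
have {}Ax : A (pt y).
  by rewrite -fxy -point_of_pt.
have /open_OmegaP HA : open (\pi_Airplane @^-1` A) by exact: oA.
have [n An] : exists n, forall z : Omega,
    truncate z n = truncate (SigSub (mem_set Oy)) n -> A (point_of z).
  by apply: HA; rewrite /= -/(point_of _) -ptE.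
have [m Hm] := Hn n; exists m => x' xx'.
have [y' [Oy' fxy' yy']] := Hm _ (set_valP x') xx'.
rewrite /= -/(point_of _) point_of_pt fxy' (ptE Oy'); exact: An.
Qed.

Lemma cellP e p : is_edge e ->
  cell e p <-> exists2 w, Omega (prepend e w) & p = pt (prepend e w).
Proof.
move=> ee; split=> [[x /= xe <-]|[w Ow ->]].
  exists (fun i => (set_val x : nat -> letter) (size e + i)).
    by rewrite -[X in prepend X]xe -prepend_mkseq; exact: set_valP.
  by rewrite point_of_pt -[X in prepend X]xe -prepend_mkseq.
by exists (SigSub (mem_set Ow)); rewrite ?(ptE Ow) //= /truncate mkseq_prepend0.
Qed.

(** The point of a generic word lies in no other cells than those of its prefixes. *)
Lemma cell_prefix e e' w : generic (prepend e w) -> is_edge e' ->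
  cell e' (pt (prepend e w)) -> size e' <= size e -> prefix e' e.
Proof.
move=> g ee' /(cellP _ ee')[w' Ow' /(pt_generic g Ow') E] le.
rewrite prefixE -[X in take _ X](mkseq_prepend0 e w) E -(subnKC le) mkseq_prepend.
by rewrite take_size_cat.
Qed.

(** These are the edges of the graph [Gamma_N]. *)
Definition level (N : nat) : seq word :=
  [seq tval t | t <- enum {: N.+1.-tuple letter} & is_edge (tval t)].

Lemma mem_level N e : (e \in level N) = is_edge e && (size e == N.+1).
Proof.
apply/mapP/andP => [[t + ->]|[ee /eqP sz]].
  by rewrite mem_filter size_tuple eqxx => /andP[].
have sz' : size e == N.+1 by apply/eqP.
by exists (Tuple sz') => //; rewrite mem_filter ee mem_enum.
Qed.

Lemma cell_mkseq x N : Omega x -> cell (mkseq (x : nat -> letter) N.+1) (pt x).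
Proof.
move=> Ox; apply/cellP; first exact: Ox.
by exists (fun i => x (N.+1 + i)); rewrite -prepend_mkseq.
Qed.

(** Two cells of the same level have disjoint interiors: an open set meeting both
    would contain a generic point, and this lies in one cell of each level only. *)
Lemma level_partition N : cellular_partition (level N).
Proof.
split.
- by apply/allP => e; rewrite mem_level => /andP[].
- rewrite -subTset => p _; have [x Ox ->] := pt_surj p.
  exists (mkseq (x : nat -> letter) N.+1); last exact: cell_mkseq.
  by rewrite /= mem_level size_mkseq eqxx andbT; exact: Ox.
move=> e e'; rewrite !mem_level => /andP[ee /eqP se] /andP[ee' /eqP se'] /eqP ne.
rewrite -subset0 => p; have [x Ox ->] := pt_surj p => xO.
have oO : open ((cell e)° `&` (cell e')°) by apply: openI; exact: open_interior.
have [n Hn] : exists n, forall y : Omega, truncate y n =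
     truncate (SigSub (mem_set Ox)) n ->
     ((cell e)° `&` (cell e')°) (point_of y).
  have /open_OmegaP := oO; apply; rewrite /= -/(point_of _) -ptE; exact: xO.
have eg : is_edge (mkseq (x : nat -> letter) (n + N.+1)).
  by apply: Omega_edge; rewrite // addnS.
have [w gw] := generic_edge eg; have [Ow _] := gw.
have [] := Hn (SigSub (mem_set Ow)).
  rewrite /truncate /=; apply: (@eq_mkseq_le _ _ _ (n + N.+1)); first exact: leq_addr.
  by rewrite -[X in mkseq _ X](size_mkseq (x : nat -> letter)) mkseq_prepend0.
rewrite -ptE => /interior_subset/(cell_prefix gw ee) pe.
move=> /interior_subset/(cell_prefix gw ee') pe'.
case: ne; have := pe; rewrite se size_mkseq leq_addl => /(_ isT).
have := pe'; rewrite se' size_mkseq leq_addl => /(_ isT).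
by rewrite !prefixE se se' => /eqP <- /eqP <-.
Qed.

(** Any cellular partition is refined by a full expansion, as the prefix of a generic
    word naming a cell of the partition has bounded length. *)
Lemma T_AP f : T_A f <-> homeomorphism f /\
  exists N, forall e, is_edge e -> size e = N.+1 -> exists e', canonical_on f e e'.
Proof.
split=> [[hf [P [PE cov _] fP]]|[hf [N fN]]]; split=> //; last first.
  exists (level N); first exact: level_partition.
  by move=> e; rewrite mem_level => /andP[ee /eqP]; exact: fN.
exists (\max_(p <- P) size p) => e ee se.
have [w gw] := generic_edge ee.
have [p /= pP pc] : (\bigcup_(e in [set` P]) cell e) (pt (prepend e w)) by rewrite cov.
have le : size p <= size e by rewrite se leqW //; exact: leq_bigmax_seq.
have /prefixP[s E] := cell_prefix gw (allP PE _ pP) pc le.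
have [p' fp] := fP p pP; exists (p' ++ s).
by rewrite E; apply: canonical_cat; rewrite -?E.
Qed.

Lemma homeo_inv f g : cancel f g -> cancel g f ->
  homeomorphism f -> homeomorphism (g : Airplane -> Airplane).
Proof.
move=> fK gK [cf [g' [cg' fK' gK']]].
have -> : g = g'.
  by apply/funext => p; rewrite -[in LHS](gK' p) fK.
by split=> //; exists f.
Qed.

Lemma canonical_level f N e : 
  (forall e, is_edge e -> size e = N.+1 -> exists e', canonical_on f e e') ->
  is_edge e -> N < size e -> exists e', canonical_on f e e' /\ size e - N <= size e'.
Proof.
move=> fN ee lt.
have e0 : take N.+1 e != [::] by case: (e) ee.
have et : is_edge (take N.+1 e).
  by apply: (@is_edge_prefix _ (drop N.+1 e)) => //; rewrite cat_take_drop.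
have [e' fe'] := fN _ et (size_takel lt).
exists (e' ++ drop N.+1 e); split.
  by rewrite -[X in canonical_on f X](cat_take_drop N.+1 e);
    apply: canonical_cat => //; rewrite cat_take_drop.
rewrite size_cat size_drop -subSS (subSn lt) -add1n leq_add //.
by case: fe' => _; case: (e').
Qed.

(** A generic point of a deep cell comes from some cell of level [N], and lies in the
    image of that cell; the image has a bounded name, a prefix of the deep one. *)
Lemma image_cells f N : homeomorphism f ->
  (forall e, is_edge e -> size e = N.+1 -> exists e', canonical_on f e e') ->
  exists im : word -> word, (forall e, e \in level N -> canonical_on f e (im e)) /\
    exists M, forall e, is_edge e -> size e = M.+1 ->
      exists2 e1, e1 \in level N & prefix (im e1) e.
Proof.
move=> [_ [g [_ fK gK]]] fN.
have [im fim] : exists im : word -> word, forall e, e \in level N ->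
    canonical_on f e (im e).
  have : forall e, exists e', e \in level N -> canonical_on f e e'.
    move=> e; case El : (e \in level N); last by exists [::].
    move: El; rewrite mem_level => /andP[ee /eqP se].
    by have [e' fe'] := fN e ee se; exists e'.
  by move=> /choice[im H]; exists im.
exists im; split=> //.
exists (\max_(e <- level N) size (im e)) => e ee se.
have [w gw] := generic_edge ee; have [Ow _] := gw.
have [x Ox gx] := pt_surj (g (pt (prepend e w))).
pose e1 := mkseq (x : nat -> letter) N.+1.
have e1l : e1 \in level N by rewrite mem_level size_mkseq eqxx andbT; exact: Ox.
have fe1 := fim _ e1l; have [_ ie _ _] := fe1.
exists e1 => //; apply: (cell_prefix gw ie).
  have /cellP := @cell_mkseq x N Ox; case; first exact: Ox.
  move=> u Ou xu; rewrite -[pt _]gK gx xu.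
  have /canonicalP[e1e _ C H] := fe1; rewrite H //; apply/(cellP _ ie).
  by exists u => //; exact: Omega_recolour Ou.
by rewrite se leqW //; exact: (leq_bigmax_seq (F := fun e => size (im e))).
Qed.

(** Full expansions of large level are convenient for composing and inverting:
    the level of the cells on which a product is canonical just adds up. *)
Lemma T_A_group : permutation_group T_A.
Proof.
split.
- apply/T_AP; split; last by exists 0 => e ee _; exists e; exact: canonical_id.
  have ci : continuous (@id Airplane) by move=> x A.
  by split=> //; exists id.
- move=> f g /T_AP[[cf [f' [cf' fK fK']]] [M fM]] /T_AP[[cg [g' [cg' gK gK']]] [N gN]].
  apply/T_AP; split.
    split; first by move=> x; apply: continuous_comp; [exact: cg|exact: cf].
    exists (g' \o f'); split; [|exact: can_comp|exact: can_comp].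
    by move=> x; apply: continuous_comp; [exact: cf'|exact: cg'].
  exists (M + N) => e ee se.
  have [|e' [ge' le]] := canonical_level gN ee; first by rewrite se ltnS leq_addl.
  have [||e'' [fe'' _]] := canonical_level fM (e := e').
  + by case: ge'.
  + by apply: leq_trans le; rewrite se -addSn addnK.
  by exists e''; exact: canonical_comp ge' fe''.
move=> f /[dup] Tf /T_AP[hf [N fN]]; have [_ [g [cg fK gK]]] := hf.
exists g => //; apply/T_AP; split; first exact: homeo_inv hf.
have [im [fim [M HM]]] := image_cells hf fN.
exists M => e ee se; have [e1 e1l /prefixP[s E]] := HM e ee se.
exists (e1 ++ s); rewrite E; apply: canonical_cat; first by rewrite -E.
exact: canonical_inv (fim _ e1l).
Qed.

(** * Rearrangements given by rules *)

Lemma limit_prepend_incident e w v : limit (prepend e w) v -> size v.1 < size e ->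
  incident v e.
Proof. by move=> xv /(limit_incident xv); rewrite mkseq_prepend0. Qed.

(** The edges meeting an end of a cell form a single branch below it. *)
Lemma limit_end e w b : is_edge e -> Omega (prepend e w) ->
  limit (prepend e w) (side e b) -> w = ray (edge_colour e) b.
Proof.
move=> ee Ow xv; apply: ray_unique => // n; first exact: (Omega_prepend w ee).1.
rewrite -mkseq_prepend; apply: limit_incident => //.
by apply: leq_trans (size_side _ _) _; rewrite ?is_edge_nil ?leq_addr.
Qed.

(** Vertices created inside a cell are carried along when the cell is replaced by
    another one. *)
Lemma limit_inside e e' w p n : e != [::] -> limit (prepend e w) (e ++ p, n) ->
  limit (prepend e' w) (e' ++ p, n).
Proof.
move=> e0 xv; exists (size e' + (size p).+1) => m le.
have [k mE] : exists k, m = size e' + k.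
  by exists (m - size e'); rewrite subnKC //; apply: leq_trans le; rewrite leq_addr.
move: le; rewrite mE leq_add2l mkseq_prepend => le.
apply: (@incident_transfer e) => //; rewrite -mkseq_prepend; apply: limit_incident => //=.
by rewrite size_cat -addnS leq_add2l.
Qed.

(** An enumeration of the edges of a level that evaluates. *)
Fixpoint edges (n : nat) : seq word :=
  if n is n'.+1 then
    flatten [seq [seq rcons e c | c <- replacement (edge_colour e)] | e <- edges n']
  else [seq [:: c] | c <- base_graph].

Lemma mem_edges n e : is_edge e -> size e = n.+1 -> e \in edges n.
Proof.
elim: n e => [|n IH] e; case/lastP: e => // e c.
  by rewrite size_rcons => + [/size0nil E]; rewrite E => /andP[cb _]; apply: (map_f (fun c => [:: c]) cb).
have [->//|e0] := eqVneq e [::].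
rewrite is_edge_rcons // size_rcons => /andP[ee gr] [se].
by apply/flatten_mapP; exists e; [exact: IH | exact: map_f].
Qed.

Definition prefix_of (e p : word) : bool := prefix p e.

(** The cells of [P] subdivide the limit space. The test is made on the words of
    length four, the greatest length occurring in the rules of the five elements once
    reversals are expanded. *)
Definition complete (P : seq word) : bool :=
  all (fun p => is_edge p && (size p <= 4)) P &&
  all (fun e => count (prefix_of e) P == 1) (edges 3).

Lemma complete_prefix P x : complete P -> Omega x ->
  exists p w, [/\ p \in P, is_edge p & x = prepend p w].
Proof.
move=> /andP[/allP HP /allP HE] Ox.
have /HE : mkseq (x : nat -> letter) 4 \in edges 3.
  by apply: mem_edges; rewrite ?size_mkseq //; exact: Ox.
move=> /eqP c1; have : has (prefix_of (mkseq (x : nat -> letter) 4)) P.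
  by rewrite has_count c1.
case/hasP=> p pP; have /andP[ep sp] := HP p pP.
rewrite /prefix_of prefixE => /eqP E; exists p, (fun i => x (size p + i)); split=> //.
by rewrite -[X in prepend X]E /mkseq -map_take take_iota (minn_idPl sp);
  exact: prepend_mkseq.
Qed.

Lemma complete_unique P x p q w u : complete P -> Omega x -> p \in P -> q \in P ->
  x = prepend p w -> x = prepend q u -> p = q.
Proof.
move=> /andP[/allP HP /allP HE] Ox pP qP xp xq.
have /HE : mkseq (x : nat -> letter) 4 \in edges 3.
  by apply: mem_edges; rewrite ?size_mkseq //; exact: Ox.
have pre r t : r \in P -> x = prepend r t ->
    r \in seq.filter (prefix_of (mkseq (x : nat -> letter) 4)) P.
  move=> rP ->; have /andP[_ sr] := HP r rP.
  by rewrite mem_filter rP /prefix_of -(subnKC sr) mkseq_prepend prefix_prefix.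
move: (pre p w pP xp) (pre q u qP xq); rewrite -size_filter.
case: (seq.filter _ _) => [|r []] //.
by rewrite !inE => /eqP-> /eqP->.
Qed.

(** Cells glued at an end are sent to cells glued at the corresponding ends. *)
Definition compatible (rs : seq (word * word)) : bool :=
  all (fun r => all (fun r' => ((r.1 == r'.1) ==> (r.2 == r'.2)) &&
    all (fun b => all (fun b' =>
    (side r.1 b == side r'.1 b') ==> (side r.2 b == side r'.2 b'))
    [:: false; true]) [:: false; true]) rs) rs.

Lemma compatibleP rs p p' q q' b b' : compatible rs ->
  (p, p') \in rs -> (q, q') \in rs -> side p b = side q b' -> side p' b = side q' b'.
Proof.
have B c : c \in [:: false; true] by case: c.
move=> /allP H /H /allP{}H /H /andP[_] /allP/(_ b (B b))/allP/(_ b' (B b')).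
by move=> /implyP /= {}H E; apply/eqP/H/eqP.
Qed.

Lemma compatible_fun rs p q q' : compatible rs ->
  (p, q) \in rs -> (p, q') \in rs -> q = q'.
Proof. by move=> /allP H /H /allP{}H /H /andP[]; rewrite eqxx => /eqP. Qed.

Definition swap (rs : seq (word * word)) := [seq (r.2, r.1) | r <- rs].

Lemma mem_swap rs p q : ((p, q) \in swap rs) = ((q, p) \in rs).
Proof.
apply/mapP/idP => [[[a b] ab [-> ->]]//|qp]; by exists (q, p).
Qed.

(** Colours are compared through their replacement graphs, which have a boolean
    equality. *)
Definition recolouring (rs : seq (word * word)) : bool :=
  all (fun r => replacement (edge_colour r.1) == replacement (edge_colour r.2)) rs.

Definition well_formed (rs : seq (word * word)) : bool :=
  [&& complete (unzip1 rs), complete (unzip2 rs), compatible rs,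
      compatible (swap rs) & recolouring rs].

Lemma well_formed_swap rs : well_formed rs -> well_formed (swap rs).
Proof.
case/and5P=> c1 c2 k1 k2 /allP C; apply/and5P; split=> //.
- by rewrite /unzip1 -map_comp.
- by rewrite /unzip2 -map_comp.
- by rewrite /swap -map_comp /comp /= (eq_map (g := id)) ?map_id // => -[].
by apply/allP => -[a b]; rewrite mem_swap => /C /=; rewrite eq_sym.
Qed.

Section Rules.
Variables (rs : seq (word * word)) (wf : well_formed rs).

Let c1 : complete (unzip1 rs). Proof. by case/and5P: wf. Qed.
Let c2 : complete (unzip2 rs). Proof. by case/and5P: wf. Qed.
Let comp : compatible rs. Proof. by case/and5P: wf. Qed.

Let edge1 p q : (p, q) \in rs -> is_edge p.
Proof.
move=> /(map_f fst) H; have /andP[/allP HP _] := c1.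
by have /andP[] := HP _ H.
Qed.

Let edge2 p q : (p, q) \in rs -> is_edge q.
Proof.
move=> /(map_f snd) H; have /andP[/allP HP _] := c2.
by have /andP[] := HP _ H.
Qed.

Let colour12 p q : (p, q) \in rs -> edge_colour p = edge_colour q.
Proof.
move=> H; case/and5P: wf => _ _ _ _ /allP/(_ _ H)/eqP /=.
by case: (edge_colour p); case: (edge_colour q).
Qed.

Definition rewrites (x y : sequences) : Prop :=
  exists p q w, [/\ (p, q) \in rs, x = prepend p w & y = prepend q w].

Lemma rewrites_Omega x y : rewrites x y -> Omega x -> Omega y.
Proof.
move=> [p [q [w [pq -> ->]]]]; apply: Omega_recolour.
- exact: edge1 pq.
- exact: edge2 pq.
- exact: colour12 pq.
Qed.

Lemma rewrites_total x : Omega x -> exists y, rewrites x y.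
Proof.
move=> Ox; have [p [w [/mapP[[a b] ab /= ->] _ E]]] := complete_prefix c1 Ox.
by exists (prepend b w), a, b, w.
Qed.

(** Equivalent words are rewritten to equivalent ones. They converge to a common
    vertex [v]. If [v] is created inside a cell of the rules, both words lie in that
    cell, and [v] is carried along. Otherwise both are rays to an end of their cells,
    and the rules glue the images of these ends. *)
Lemma rewrites_pt x y x' y' : Omega x -> Omega x' ->
  rewrites x y -> rewrites x' y' -> pt x = pt x' -> pt y = pt y'.
Proof.
move=> Ox Ox' Rx Rx'; have Oy := rewrites_Omega Rx Ox.
have Oy' := rewrites_Omega Rx' Ox'.
move: Rx Rx' Ox Ox' Oy Oy' =>
  [p [p' [s [pp -> ->]]]] [q [q' [t [qq -> ->]]]] Ox Ox' Oy Oy'.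
have pP := map_f fst pp; have qP := map_f fst qq.
have ep := edge1 pp; have eq_ := edge1 qq.
have p0 := is_edge_nil ep; have q0 := is_edge_nil eq_.
have same : prepend p s = prepend q t -> pt (prepend p' s) = pt (prepend q' t).
  move=> E; have pq : p = q := complete_unique c1 Ox pP qP erefl E.
  rewrite pq in E pp; rewrite (compatible_fun comp pp qq).
  by rewrite (prepend_inj E).
move=> /(pt_eq Ox Ox')[//|[v [xv yv]]].
have [lt|le] := ltnP (size v.1) (size p); last first.
  have [r vE] : exists r, v.1 = p ++ r.
    have := limit_prefix xv; rewrite -(subnKC le) mkseq_prepend => ->.
    by eexists.
  have vt : v.1 = mkseq (prepend q t : nat -> letter) (size v.1) := limit_prefix yv.
  have pq : p = q.
    pose z (i : nat) := (prepend q t : nat -> letter) (size p + i).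
    apply: (@complete_unique _ (prepend q t) _ _ z t c1 Ox' pP qP) => //.
    suff <- : mkseq (prepend q t : nat -> letter) (size p) = p.
      exact: prepend_mkseq.
    move: vt; rewrite -(subnKC le) mkseqD {1}vE => /eqP.
    by rewrite eqseq_cat ?size_mkseq // => /andP[/eqP].
  subst q; have pq' := compatible_fun comp pp qq.
  rewrite -pq' in Oy' *; apply/(pt_eq Oy Oy'); right.
  exists (p' ++ r, v.2); split; apply: (@limit_inside p) => //.
  - by rewrite -vE -surjective_pairing.
  - by rewrite -vE -surjective_pairing.
have [lt'|le'] := ltnP (size v.1) (size q); last first.
  have vs : v.1 = mkseq (prepend p s : nat -> letter) (size v.1) := limit_prefix xv.
  have := limit_prefix yv; rewrite -{1}(subnKC le') mkseq_prepend => vE.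
  suff pq : p = q by move: lt; rewrite pq ltnNge le'.
  pose z (i : nat) := (prepend p s : nat -> letter) (size q + i).
  apply: (@complete_unique _ (prepend p s) _ _ s z c1 Ox pP qP) => //.
  suff qE : mkseq (prepend p s : nat -> letter) (size q) = q.
    by have := prepend_mkseq (prepend p s) (size q); rewrite qE.
  move: vs; rewrite {1}vE -(subnKC le') mkseqD => /eqP.
  by rewrite eqseq_cat ?size_mkseq // => /andP[/eqP].
have /incidentP[b vb] := limit_prepend_incident xv lt.
have /incidentP[b' vb'] := limit_prepend_incident yv lt'.
rewrite vb in xv; rewrite vb' in yv.
have sE := limit_end ep Ox xv; have tE := limit_end eq_ Ox' yv.
have E : side p b = side q b' by rewrite -vb.
have E' := compatibleP comp pp qq E.
have ep' := edge2 pp; have eq' := edge2 qq.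
by rewrite sE tE (colour12 pp) (colour12 qq); apply/end_pt_eq.
Qed.

End Rules.

Lemma rules_map rs : well_formed rs -> exists f : Airplane -> Airplane,
  (forall p q, (p, q) \in rs -> canonical_on f p q) /\
  (forall x y, Omega x -> rewrites rs x y -> f (pt x) = pt y).
Proof.
move=> wf.
have [f fE] : exists f : Airplane -> Airplane,
    forall x y, Omega x -> rewrites rs x y -> f (pt x) = pt y.
  have : forall a : Airplane, exists b,
      forall x y, Omega x -> a = pt x -> rewrites rs x y -> b = pt y.
    move=> a; have [x Ox ->] := pt_surj a.
    have [y Rxy] := rewrites_total wf Ox.
    by exists (pt y) => x' y' Ox' E R'; exact: (rewrites_pt wf Ox Ox').
  by move=> /choice[f fE]; exists f => x y Ox Rxy; exact: fE Ox erefl Rxy.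
exists f; split=> // p q pq; apply/canonicalP.
have /and5P[c1 c2 _ _ /allP /(_ _ pq) C] := wf.
have /andP[/allP /(_ _ (map_f fst pq)) /andP[ep _] _] := c1.
have /andP[/allP /(_ _ (map_f snd pq)) /andP[eq_ _] _] := c2.
split=> //; first by move: C => /=; case: (edge_colour p); case: (edge_colour q).
by move=> w Ow; apply: fE => //; exists p, q, w.
Qed.

Lemma rules_continuous rs f : well_formed rs ->
  (forall x y, Omega x -> rewrites rs x y -> f (pt x) = pt y) -> continuous f.
Proof.
move=> wf fE; apply: continuous_pt => x Ox.
have [_ [p [q [w [pq xE _]]]]] := rewrites_total wf Ox.
have R : rewrites rs x (prepend q w) by exists p, q, w.
exists (prepend q w); split; [exact: rewrites_Omega R Ox | exact: fE |].
move=> n; exists (size p + n) => x' Ox' E.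
have [w' x'E ww'] : exists2 w' : nat -> letter,
    x' = prepend p w' & mkseq w' n = mkseq w n.
  move: E; rewrite xE mkseq_prepend mkseqD => /eqP.
  rewrite eqseq_cat ?size_mkseq // => /andP[/eqP E1 /eqP E2].
  by exists (fun i => x' (size p + i)); rewrite // -[X in prepend X]E1 -prepend_mkseq.
have R' : rewrites rs x' (prepend q w') by exists p, q, w'.
exists (prepend q w'); split; [exact: rewrites_Omega R' Ox' | exact: fE |].
apply: (@eq_mkseq_le _ _ _ (size q + n)); first exact: leq_addl.
by rewrite !mkseq_prepend ww'.
Qed.

(** The rules read backwards define the inverse map. *)
Lemma rules_T_A rs : well_formed rs -> exists f : Airplane -> Airplane,
  (forall p q, (p, q) \in rs -> canonical_on f p q) /\ T_A f.
Proof.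
move=> wf; have wf' := well_formed_swap wf.
have [f [fc fE]] := rules_map wf; have [g [_ gE]] := rules_map wf'.
exists f; split=> //; apply/T_AP; split.
  have K : cancel f g.
    move=> a; have [x Ox ->] := pt_surj a.
    have [y R] := rewrites_total wf Ox; rewrite (fE x y) //.
    apply: gE; first exact: rewrites_Omega R Ox.
    by case: R => p [q [w [pq -> ->]]]; exists q, p, w; rewrite mem_swap.
  have K' : cancel g f.
    move=> a; have [x Ox ->] := pt_surj a.
    have [y R] := rewrites_total wf' Ox; rewrite (gE x y) //.
    apply: fE; first exact: rewrites_Omega R Ox.
    by case: R => p [q [w [pq -> ->]]]; exists q, p, w; rewrite -mem_swap.
  split; first exact: rules_continuous fE.
  by exists g; split=> //; exact: rules_continuous gE.
exists 3 => e ee se; have [w [Ow _]] := generic_edge ee.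
have /and5P[c1 _ _ _ _] := wf.
have [p [u [/mapP[[a b] ab /= pE] ep E]]] := complete_prefix c1 Ow.
have sp : size p <= 4.
  by have /andP[/allP /(_ _ (map_f fst ab)) /andP[]] := c1; rewrite pE.
have eE : e = p ++ mkseq u (4 - size p).
  by rewrite -(mkseq_prepend0 e w) E -mkseq_prepend subnKC // se.
exists (b ++ mkseq u (4 - size p)); rewrite eE; apply: canonical_cat.
  by rewrite -eE.
by rewrite pE; exact: fc.
Qed.

Definition pairs (r : rule) : seq (word * word) :=
  match r with
  | Canonically e e' => [:: (e, e')]
  | Reversed e e' => [:: (rcons e bm, rcons e' bp); (rcons e bp, rcons e' bm);
                         (rcons e eu, rcons e' ed); (rcons e ed, rcons e' eu)]
  end.

Lemma acts_byP rs f : acts_by rs f <->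
  forall p q, (p, q) \in flatten [seq pairs r | r <- rs] -> canonical_on f p q.
Proof.
have P r : obeys f r <-> forall p q, (p, q) \in pairs r -> canonical_on f p q.
  case: r => e e' /=; split.
  - by move=> H p q; rewrite inE => /eqP[-> ->].
  - by move=> H; apply: H; rewrite inE.
  - by move=> [H1 H2 H3 H4] p q; rewrite !inE => /or4P[] /eqP[-> ->].
  - by move=> H; split; apply: H; rewrite !inE eqxx ?orbT.
elim: rs => [|r rs IH] /=; first by split.
split=> [[/P H1 /IH H2] p q|H]; first by rewrite mem_cat => /orP[/H1|/H2].
by split; [apply/P|apply/IH] => p q pq; apply: H; rewrite mem_cat pq ?orbT.
Qed.

Lemma acts_by_exists rs : well_formed (flatten [seq pairs r | r <- rs]) ->
  exists f, unique (acts_by rs) f /\ T_A f.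
Proof.
move=> wf; have [f [fc Tf]] := rules_T_A wf; exists f; split=> //.
split; first exact/acts_byP.
move=> g /acts_byP gc; apply/funext => a; have [x Ox ->] := pt_surj a.
have [_ [p [q [w [pq xE _]]]]] := rewrites_total wf Ox.
have /canonicalP[_ _ _ fw] := fc _ _ pq; have /canonicalP[_ _ _ gw] := gc _ _ pq.
by rewrite xE in Ox *; rewrite fw // gw.
Qed.

Lemma wf_alpha : well_formed (flatten [seq pairs r | r <- alpha_rules]).
Proof. by vm_compute. Qed.
Lemma wf_beta : well_formed (flatten [seq pairs r | r <- beta_rules]).
Proof. by vm_compute. Qed.
Lemma wf_gamma : well_formed (flatten [seq pairs r | r <- gamma_rules]).
Proof. by vm_compute. Qed.
Lemma wf_delta : well_formed (flatten [seq pairs r | r <- delta_rules]).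
Proof. by vm_compute. Qed.
Lemma wf_epsilon : well_formed (flatten [seq pairs r | r <- epsilon_rules]).
Proof. by vm_compute. Qed.

(** * Labelled expansions *)

Definition carries (h : Airplane -> Airplane) (flip : bool) (z w : word) : Prop :=
  if flip then reversed_on h z w else canonical_on h z w.

Lemma blue_grows e c : edge_colour e = Blue -> c \in [:: bm; bp; eu; ed] ->
  grows (edge_colour e) c.
Proof. by move=> ->. Qed.

Lemma red_grows e c : edge_colour e = Red -> c \in [:: r1; r2; es] ->
  grows (edge_colour e) c.
Proof. by move=> ->. Qed.

Lemma bm_blue e : is_edge (rcons e bm) -> is_edge e /\ edge_colour e = Blue.
Proof.
have [->//|e0] := eqVneq e [::].
by rewrite is_edge_rcons // => /andP[ee]; case: (edge_colour e).
Qed.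

Lemma reversed_edge h z w : reversed_on h z w ->
  [/\ is_edge z, is_edge w, edge_colour z = Blue & edge_colour w = Blue].
Proof.
move=> [[/bm_blue[? ?] _ _ _] [_ /bm_blue[? ?] _ _] _ _]; by split.
Qed.

Lemma carries_edge h fl z w : carries h fl z w ->
  [/\ is_edge z, is_edge w & edge_colour z = edge_colour w].
Proof.
by case: fl => [/reversed_edge[? ? -> ->]|[]].
Qed.

(** Two reversals compose to a canonical map, by gluing the four parts. *)
Lemma carries_comp g h fl fl' z w w' : edge_colour w = Blue ->
  carries h fl z w -> carries g fl' w w' -> carries (g \o h) (fl (+) fl') z w'.
Proof.
move=> C H; have [ez ew Czw] := carries_edge H.
have Cz : edge_colour z = Blue by rewrite Czw.
case: fl H => H; case: fl' => /= H'.
- have [_ ew' _ Cw'] := reversed_edge H'.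
  case: H H' => [A1 A2 A3 A4] [B1 B2 B3 B4].
  apply: canonical_glue; rewrite ?Cz // => c; rewrite /grows !inE.
  case/or4P=> /eqP->.
  + exact: canonical_comp A1 B2.
  + exact: canonical_comp A2 B1.
  + exact: canonical_comp A3 B4.
  + exact: canonical_comp A4 B3.
- have P c : c \in [:: bm; bp; eu; ed] -> canonical_on g (rcons w c) (rcons w' c).
    by move=> cb; apply: canonical_rcons H'; exact: blue_grows.
  case: H => [A1 A2 A3 A4]; split.
  + by apply: canonical_comp A1 (P _ _).
  + by apply: canonical_comp A2 (P _ _).
  + by apply: canonical_comp A3 (P _ _).
  + by apply: canonical_comp A4 (P _ _).
- have P c : c \in [:: bm; bp; eu; ed] -> canonical_on h (rcons z c) (rcons w c).
    by move=> cb; apply: canonical_rcons H; exact: blue_grows.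
  case: H' => [A1 A2 A3 A4]; split.
  + by apply: canonical_comp (P _ _) A1.
  + by apply: canonical_comp (P _ _) A2.
  + by apply: canonical_comp (P _ _) A3.
  + by apply: canonical_comp (P _ _) A4.
- exact: canonical_comp H H'.
Qed.

Lemma carries_inv f g fl z w : cancel f g -> carries f fl z w -> carries g fl w z.
Proof.
by move=> K; case: fl => [[A1 A2 A3 A4]|]; [split|]; exact: canonical_inv.
Qed.

(** An expansion is given by the subdivision trees of the four edges of the base
    graph. Its edges are labelled by words, blue ones together with a relative
    orientation. *)
Inductive red := RedLeaf of word | RedNode of red & red & blue
with blue := BlueLeaf of word & bool | BlueNode of blue & blue & red & red.

Scheme red_mut := Induction for red Sort Prop
with blue_mut := Induction for blue Sort Prop.
Combined Scheme tree_ind from red_mut, blue_mut.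

Variant expansion := Expansion of blue & blue & red & red.

(** Labels name cells of the source of [h] and leaves sit at their images. Composing
    with [g] on the left thus moves the leaves and keeps the labels. *)
Fixpoint red_at (h : Airplane -> Airplane) (w : word) (t : red) : Prop :=
  match t with
  | RedLeaf x => canonical_on h x w
  | RedNode a b s => [/\ red_at h (rcons w r1) a, red_at h (rcons w r2) b &
                         blue_at h (rcons w es) s]
  end
with blue_at (h : Airplane -> Airplane) (w : word) (t : blue) : Prop :=
  match t with
  | BlueLeaf z fl => carries h fl z w
  | BlueNode p q u d => [/\ blue_at h (rcons w bm) p, blue_at h (rcons w bp) q,
                            red_at h (rcons w eu) u & red_at h (rcons w ed) d]
  end.

Definition describes (h : Airplane -> Airplane) (T : expansion) : Prop :=
  let: Expansion L R U D := T in
  [/\ blue_at h [:: eL] L, blue_at h [:: eR] R, red_at h [:: eU] U &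
      red_at h [:: eD] D].

(** Labels are listed with their colour, [true] for red. *)
Fixpoint red_labels (t : red) : seq (bool * word) :=
  match t with
  | RedLeaf x => [:: (true, x)]
  | RedNode a b s => red_labels a ++ red_labels b ++ blue_labels s
  end
with blue_labels (t : blue) : seq (bool * word) :=
  match t with
  | BlueLeaf z _ => [:: (false, z)]
  | BlueNode p q u d =>
      blue_labels p ++ blue_labels q ++ red_labels u ++ red_labels d
  end.

Definition labels (T : expansion) : seq (bool * word) :=
  let: Expansion L R U D := T in
  blue_labels L ++ blue_labels R ++ red_labels U ++ red_labels D.

(** A blue edge has an orientation-reversing symmetry, which exchanges the edges of
    its subdivision without reversing them. *)
Definition mirror (t : blue) : blue :=
  match t with
  | BlueLeaf z fl => BlueLeaf z (~~ fl)
  | BlueNode p q u d => BlueNode q p d u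
  end.

Lemma mirrorK : involutive mirror.
Proof. by case=> //= z fl; rewrite negbK. Qed.

Lemma mem_mirror t : blue_labels (mirror t) =i blue_labels t.
Proof.
case: t => //= p q u d x; rewrite !mem_cat.
by do 4!case: (x \in _).
Qed.

(** A map canonical on the cell where a tree is placed moves the tree as a whole. *)
Lemma tree_move g h :
  (forall t w w', edge_colour w = Red -> canonical_on g w w' ->
     red_at h w t -> red_at (g \o h) w' t) /\
  (forall t w w', edge_colour w = Blue -> canonical_on g w w' ->
     blue_at h w t -> blue_at (g \o h) w' t).
Proof.
apply: tree_ind => [x|a Ha b Hb s Hs|z fl|p Hp q Hq u Hu d Hd] w w' C H /=.
- by move=> H'; exact: canonical_comp H' H.
- have K c : c \in [:: r1; r2; es] -> canonical_on g (rcons w c) (rcons w' c).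
    by move=> ?; apply: canonical_rcons => //; exact: red_grows.
  case=> A B S; split.
  + by apply: Ha A; rewrite ?edge_colour_rcons //; exact: K.
  + by apply: Hb B; rewrite ?edge_colour_rcons //; exact: K.
  + by apply: Hs S; rewrite ?edge_colour_rcons //; exact: K.
- by move=> H'; have := @carries_comp g h fl false z w w' C H' H; rewrite addbF.
- have K c : c \in [:: bm; bp; eu; ed] -> canonical_on g (rcons w c) (rcons w' c).
    by move=> ?; apply: canonical_rcons => //; exact: blue_grows.
  case=> P Q U D; split.
  + by apply: Hp P; rewrite ?edge_colour_rcons //; exact: K.
  + by apply: Hq Q; rewrite ?edge_colour_rcons //; exact: K.
  + by apply: Hu U; rewrite ?edge_colour_rcons //; exact: K.
  + by apply: Hd D; rewrite ?edge_colour_rcons //; exact: K.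
Qed.

Lemma red_move g h w w' t : edge_colour w = Red -> canonical_on g w w' ->
  red_at h w t -> red_at (g \o h) w' t.
Proof. exact: (tree_move g h).1. Qed.

Lemma blue_move g h w w' t : edge_colour w = Blue -> canonical_on g w w' ->
  blue_at h w t -> blue_at (g \o h) w' t.
Proof. exact: (tree_move g h).2. Qed.

Lemma blue_move_mirror g h w w' t : reversed_on g w w' ->
  blue_at h w t -> blue_at (g \o h) w' (mirror t).
Proof.
move=> H; have [_ _ C _] := reversed_edge H; case: t => [z fl|p q u d] /=.
  by move=> H'; have := @carries_comp g h fl true z w w' C H' H; rewrite addbT.
case: H => H1 H2 H3 H4 [P Q U D]; split.
- by apply: blue_move H2 Q; rewrite edge_colour_rcons.
- by apply: blue_move H1 P; rewrite edge_colour_rcons.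
- by apply: red_move H4 D; rewrite edge_colour_rcons.
- by apply: red_move H3 U; rewrite edge_colour_rcons.
Qed.

(** * Moves between expansions *)

Section Moves.
Variable G : set (Airplane -> Airplane).
Hypothesis groupG : permutation_group G.

(** One element of [G] serves for all the maps that the expansions describe. *)
Definition reaches (T T' : expansion) : Prop :=
  {subset labels T' <= labels T} /\
  exists2 g, G g & forall h, describes h T -> describes (g \o h) T'.

Definition linked (T T' : expansion) : Prop := reaches T T' /\ reaches T' T.

Lemma reaches_refl T : reaches T T.
Proof. by split=> //; exists id => //; case: groupG. Qed.

Lemma reaches_trans T1 T2 T3 : reaches T1 T2 -> reaches T2 T3 -> reaches T1 T3.
Proof.
move=> [l1 [g Gg H]] [l2 [g' Gg' H']]; split; first by move=> x /l2 /l1.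
exists (g' \o g); first by case: groupG => _ + _; apply.
by move=> h /H /H'.
Qed.

Lemma linked_refl T : linked T T.
Proof. by split; exact: reaches_refl. Qed.

Lemma linked_sym T T' : linked T T' -> linked T' T.
Proof. by case. Qed.

Lemma linked_trans T1 T2 T3 : linked T1 T2 -> linked T2 T3 -> linked T1 T3.
Proof.
by move=> [H1 H1'] [H2 H2']; split; [exact: reaches_trans H2|exact: reaches_trans H1'].
Qed.

(** An element of [G] that moves [T] to [T'] has an inverse moving it back. *)
Lemma link T T' g : G g -> labels T =i labels T' ->
  (forall h, describes h T -> describes (g \o h) T') ->
  (forall g', cancel g g' -> cancel g' g ->
     forall h, describes h T' -> describes (g' \o h) T) -> linked T T'.
Proof.
move=> Gg l H H'; split; split.
- by move=> x; rewrite l.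
- by exists g.
- by move=> x; rewrite l.
- have [_ _ /(_ g Gg)[g' Gg' [K K']]] := groupG.
  by exists g' => // h; exact: H'.
Qed.

Variables alpha beta gamma delta epsilon : Airplane -> Airplane.
Hypothesis (Galpha : G alpha) (alphaE : acts_by alpha_rules alpha).
Hypothesis (Gbeta : G beta) (betaE : acts_by beta_rules beta).
Hypothesis (Ggamma : G gamma) (gammaE : acts_by gamma_rules gamma).
Hypothesis (Gdelta : G delta) (deltaE : acts_by delta_rules delta).
Hypothesis (Gepsilon : G epsilon) (epsilonE : acts_by epsilon_rules epsilon).

Ltac mem_labels := let x := fresh in move=> x; rewrite /= !(mem_cat, mem_mirror);
  do ?[case: (x \in _) => //=].

(** The centre of the picture moves along the left blue edge. *)
Lemma link_alpha p q u d R U D :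
  linked (Expansion (BlueNode p q u d) R U D)
         (Expansion q (BlueNode (mirror p) R U D) d u).
Proof.
have [A1 [A2 [A3 [A4 [A5 [A6 [A7 _]]]]]]] := alphaE.
apply: link Galpha _ _ _.
- by mem_labels.
- move=> h /= [[Hp Hq Hu Hd] HR HU HD]; split.
  + exact: blue_move A1 Hq.
  + split; [exact: blue_move_mirror A4 Hp|exact: blue_move A7 HR|
      exact: red_move A5 HU|exact: red_move A6 HD].
  + exact: red_move A2 Hd.
  + exact: red_move A3 Hu.
move=> g K K' h /= [Hq [Hp HR HU HD] Hd Hu].
split; [split| | | ].
- rewrite -[p]mirrorK; apply: blue_move_mirror Hp.
  exact: (@carries_inv _ _ true) A4.
- exact: blue_move (canonical_inv K A1) Hq.
- exact: red_move (canonical_inv K A3) Hu.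
- exact: red_move (canonical_inv K A2) Hd.
- exact: blue_move (canonical_inv K A7) HR.
- exact: red_move (canonical_inv K A5) HU.
- exact: red_move (canonical_inv K A6) HD.
Qed.

(** The central circle is turned by one step. *)
Lemma link_beta L R U a b s :
  linked (Expansion L R U (RedNode a b s)) (Expansion s R (RedNode U a L) b).
Proof.
have [A1 [A2 [A3 [A4 [A5 [A6 _]]]]]] := betaE.
apply: link Gbeta _ _ _.
- by mem_labels.
- move=> h /= [HL HR HU [Ha Hb Hs]]; split.
  + exact: blue_move A5 Hs.
  + exact: blue_move A6 HR.
  + by split; [exact: red_move A2 HU|exact: red_move A3 Ha|exact: blue_move A1 HL].
  + exact: red_move A4 Hb.
move=> g K K' h /= [Hs HR [HU Ha HL] Hb].
split; [ | | |split].
- exact: blue_move (canonical_inv K A1) HL.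
- exact: blue_move (canonical_inv K A6) HR.
- exact: red_move (canonical_inv K A2) HU.
- exact: red_move (canonical_inv K A3) Ha.
- exact: red_move (canonical_inv K A4) Hb.
- exact: blue_move (canonical_inv K A5) Hs.
Qed.

(** The subdivision of a red edge is reassociated. *)
Lemma link_gamma L R D a b c s t :
  linked (Expansion L R (RedNode a (RedNode b c t) s) D)
         (Expansion L R (RedNode (RedNode a b s) c t) D).
Proof.
have [A1 [A2 [A3 [A4 [A5 [A6 [A7 [A8 _]]]]]]]] := gammaE.
apply: link Ggamma _ _ _.
- by mem_labels.
- move=> h /= [HL HR [Ha [Hb Hc Ht] Hs] HD].
  split; [exact: blue_move A1 HL|exact: blue_move A3 HR| |exact: red_move A2 HD].
  split; [split| |].
  + exact: red_move A4 Ha.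
  + exact: red_move A6 Hb.
  + exact: blue_move A5 Hs.
  + exact: red_move A8 Hc.
  + exact: blue_move A7 Ht.
move=> g K K' h /= [HL HR [[Ha Hb Hs] Hc Ht] HD].
split; [exact: blue_move (canonical_inv K A1) HL
       |exact: blue_move (canonical_inv K A3) HR|
       |exact: red_move (canonical_inv K A2) HD].
split; [|split|].
- exact: red_move (canonical_inv K A4) Ha.
- exact: red_move (canonical_inv K A6) Hb.
- exact: red_move (canonical_inv K A8) Hc.
- exact: blue_move (canonical_inv K A7) Ht.
- exact: blue_move (canonical_inv K A5) Hs.
Qed.

(** The picture is turned upside down. *)
Lemma link_delta L R U D : linked (Expansion L R U D) (Expansion R L D U).
Proof.
have [A1 [A2 [A3 [A4 _]]]] := deltaE.
apply: link Gdelta _ _ _.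
- by mem_labels.
- move=> h /= [HL HR HU HD]; split.
  + exact: blue_move A2 HR.
  + exact: blue_move A1 HL.
  + exact: red_move A4 HD.
  + exact: red_move A3 HU.
move=> g K K' h /= [HR HL HD HU]; split.
- exact: blue_move (canonical_inv K A1) HL.
- exact: blue_move (canonical_inv K A2) HR.
- exact: red_move (canonical_inv K A3) HU.
- exact: red_move (canonical_inv K A4) HD.
Qed.

(** The circles strung along the right blue edge are shifted away from the centre. *)
Lemma link_epsilon L U D p q u d R u' d' :
  linked (Expansion L (BlueNode (BlueNode p q u d) R u' d') U D)
         (Expansion L (BlueNode q (BlueNode (mirror p) R u' d') d u) U D).
Proof.
have [A1 [A2 [A3 [A4 [A5 [A6 [A7 [A8 [A9 [A10 _]]]]]]]]]] := epsilonE.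
apply: link Gepsilon _ _ _.
- by mem_labels.
- move=> h /= [HL [[Hp Hq Hu Hd] HR Hu' Hd'] HU HD].
  split; [exact: blue_move A1 HL| |exact: red_move A2 HU|exact: red_move A3 HD].
  split.
  + exact: blue_move A4 Hq.
  + split; [exact: blue_move_mirror A7 Hp|exact: blue_move A10 HR|
      exact: red_move A8 Hu'|exact: red_move A9 Hd'].
  + exact: red_move A5 Hd.
  + exact: red_move A6 Hu.
move=> g K K' h /= [HL [Hq [Hp HR Hu' Hd'] Hd Hu] HU HD].
split; [exact: blue_move (canonical_inv K A1) HL|
       |exact: red_move (canonical_inv K A2) HU
       |exact: red_move (canonical_inv K A3) HD].
split; [split| | |].
- rewrite -[p]mirrorK; apply: blue_move_mirror Hp.
  exact: (@carries_inv _ _ true) A7.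
- exact: blue_move (canonical_inv K A4) Hq.
- exact: red_move (canonical_inv K A6) Hu.
- exact: red_move (canonical_inv K A5) Hd.
- exact: blue_move (canonical_inv K A10) HR.
- exact: red_move (canonical_inv K A8) Hu'.
- exact: red_move (canonical_inv K A9) Hd'.
Qed.

End Moves.

(** * Normal forms of expansions *)

(** The five elements as rewriting rules. They apply at the root of an expansion and
    move its subtrees around as they are, except that one of them may be mirrored. *)
Inductive equi : expansion -> expansion -> Prop :=
| equi_refl T : equi T T
| equi_sym T T' : equi T T' -> equi T' T
| equi_trans T T' T'' : equi T T' -> equi T' T'' -> equi T T''
| equi_alpha p q u d R U D :
    equi (Expansion (BlueNode p q u d) R U D)
         (Expansion q (BlueNode (mirror p) R U D) d u)
| equi_beta L R U a b s :
    equi (Expansion L R U (RedNode a b s)) (Expansion s R (RedNode U a L) b)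
| equi_gamma L R D a b c s t :
    equi (Expansion L R (RedNode a (RedNode b c t) s) D)
         (Expansion L R (RedNode (RedNode a b s) c t) D)
| equi_delta L R U D : equi (Expansion L R U D) (Expansion R L D U)
| equi_epsilon L U D p q u d R u' d' :
    equi (Expansion L (BlueNode (BlueNode p q u d) R u' d') U D)
         (Expansion L (BlueNode q (BlueNode (mirror p) R u' d') d u) U D).

Definition blue_equi b b' : Prop :=
  forall R U D, equi (Expansion b R U D) (Expansion b' R U D).

Definition red_equi r r' : Prop :=
  forall L R D, equi (Expansion L R r D) (Expansion L R r' D).

Lemma blue_equi_refl b : blue_equi b b.
Proof. by move=> R U D; exact: equi_refl. Qed.

Lemma red_equi_refl r : red_equi r r.
Proof. by move=> L R D; exact: equi_refl. Qed.

Lemma blue_equi_trans b b' b'' : blue_equi b b' -> blue_equi b' b'' -> blue_equi b b''.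
Proof. by move=> H H' R U D; exact: equi_trans (H R U D) (H' R U D). Qed.

Lemma red_equi_trans b b' b'' : red_equi b b' -> red_equi b' b'' -> red_equi b b''.
Proof. by move=> H H' R U D; exact: equi_trans (H R U D) (H' R U D). Qed.

Lemma blue_equi_right b b' L U D : blue_equi b b' ->
  equi (Expansion L b U D) (Expansion L b' U D).
Proof.
move=> H; apply: equi_trans (equi_delta _ _ _ _) _.
by apply: equi_trans (H _ _ _) _; exact: equi_delta.
Qed.

Lemma red_equi_down r r' L R U : red_equi r r' ->
  equi (Expansion L R U r) (Expansion L R U r').
Proof.
move=> H; apply: equi_trans (equi_delta _ _ _ _) _.
by apply: equi_trans (H _ _ _) _; exact: equi_delta.
Qed.

(** Moving the centre brings a subtree to the root, where it can be replaced. *)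
Lemma blue_equi_node p q q' u u' d d' : blue_equi q q' -> red_equi u u' ->
  red_equi d d' -> blue_equi (BlueNode p q u d) (BlueNode p q' u' d').
Proof.
move=> Hq Hu Hd R U D; apply: equi_trans (equi_alpha _ _ _ _ _ _ _) _.
apply: equi_trans (equi_sym (equi_alpha _ _ _ _ _ _ _)).
apply: equi_trans (Hq _ _ _) _; apply: equi_trans (Hd _ _ _) _.
exact: red_equi_down.
Qed.

(** Turning the central circle brings the first half of the upper edge, or its blue
    part, to the base position; turning it the other way does so for the second
    half. *)
Lemma equi_turn L R D a b s :
  equi (Expansion L R (RedNode a b s) D) (Expansion s R a (RedNode b D L)).
Proof. exact: equi_sym (equi_beta _ _ _ _ _ _). Qed.

Lemma equi_turn2 L R D a b s :
  equi (Expansion L R (RedNode a b s) D) (Expansion L s b (RedNode D a R)).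
Proof.
apply: equi_trans (equi_turn _ _ _ _ _ _) _.
apply: equi_trans (equi_delta _ _ _ _) _.
exact: equi_turn.
Qed.

Lemma red_equi_node a a' b b' s s' : red_equi a a' -> red_equi b b' ->
  blue_equi s s' -> red_equi (RedNode a b s) (RedNode a' b' s').
Proof.
move=> Ha Hb Hs L R D.
apply: (@equi_trans _ (Expansion L R (RedNode a' b s') D)).
  apply: equi_trans (equi_turn _ _ _ _ _ _) _.
  apply: equi_trans (equi_sym (equi_turn _ _ _ _ _ _)).
  exact: equi_trans (Ha _ _ _) (Hs _ _ _).
apply: equi_trans (equi_turn2 _ _ _ _ _ _) _.
apply: equi_trans (equi_sym (equi_turn2 _ _ _ _ _ _)).
exact: Hb.
Qed.

Lemma blue_equi_shift p q u d r u' d' :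
  blue_equi (BlueNode (BlueNode p q u d) r u' d')
            (BlueNode q (BlueNode (mirror p) r u' d') d u).
Proof.
move=> R U D; apply: equi_trans (equi_delta _ _ _ _) _.
by apply: equi_trans (equi_epsilon _ _ _ _ _ _ _ _ _ _) _; exact: equi_delta.
Qed.

(** A circle at the end of a blue edge can be turned about its point of
    attachment. *)
Lemma blue_equi_turn p q a b s d :
  blue_equi (BlueNode p q (RedNode a b s) d) (BlueNode p s b (RedNode d a q)).
Proof.
move=> R U D; apply: equi_trans (equi_alpha _ _ _ _ _ _ _) _.
apply: equi_trans (equi_sym (equi_alpha _ _ _ _ _ _ _)).
exact: equi_beta.
Qed.

Lemma red_equi_assoc a b c s t :
  red_equi (RedNode (RedNode a b s) c t) (RedNode a (RedNode b c t) s).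
Proof. by move=> L R D; apply: equi_sym; exact: equi_gamma. Qed.

Fixpoint red_size (t : red) : nat :=
  match t with
  | RedLeaf _ => 0
  | RedNode a b s => (red_size a + red_size b + blue_size s).+1
  end
with blue_size (t : blue) : nat :=
  match t with
  | BlueLeaf _ _ => 0
  | BlueNode p q u d => (blue_size p + blue_size q + red_size u + red_size d).+1
  end.

Lemma mirror_size t : blue_size (mirror t) = blue_size t.
Proof. by case: t => //= p q u d; lia. Qed.

(** Any red edge can be made the upper edge of the central circle. *)
Section Centre.
Variable x : word.

Let centred (T : expansion) : Prop :=
  exists L R D, equi T (Expansion L R (RedLeaf x) D).

Let centred_equi T T' : equi T T' -> centred T' -> centred T.
Proof.
by move=> TT' [L [R [D H]]]; exists L, R, D; exact: equi_trans H.
Qed.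

(* The subtree containing the edge shrinks at each move; it may also lie on the
   inner edge of a blue edge next to the centre, which is then shifted. *)
Let centre_size n :
  [/\ forall b R U D, blue_size b < n -> (true, x) \in blue_labels b ->
        centred (Expansion b R U D),
      forall p q u d R U D, blue_size p < n -> (true, x) \in blue_labels p ->
        centred (Expansion (BlueNode p q u d) R U D) &
      forall L R r D, red_size r < n -> (true, x) \in red_labels r ->
        centred (Expansion L R r D)].
Proof.
elim: n => [|n [IH1 IH2 IH3]]; first by [].
have down L R U r : red_size r < n -> (true, x) \in red_labels r ->
    centred (Expansion L R U r).
  by move=> lt H; apply: centred_equi (equi_delta _ _ _ _) _; exact: IH3.
split.
- case=> [z fl|p q u d] R U D /=; first by rewrite inE.
  rewrite ltnS !mem_cat => lt; case/or4P=> H.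
  + by apply: IH2 => //; lia.
  + by apply: centred_equi (equi_alpha _ _ _ _ _ _ _) _; apply: IH1 => //; lia.
  + by apply: centred_equi (equi_alpha _ _ _ _ _ _ _) _; apply: down => //; lia.
  + by apply: centred_equi (equi_alpha _ _ _ _ _ _ _) _; apply: IH3 => //; lia.
- case=> [z fl|p q u d] q' u' d' R U D /=; first by rewrite inE.
  rewrite ltnS !mem_cat => lt H.
  apply: centred_equi (blue_equi_shift _ _ _ _ _ _ _ _ _ _) _.
  case/or4P: H => H.
  + apply: centred_equi (equi_alpha _ _ _ _ _ _ _) _; apply: IH2.
      by rewrite mirror_size; lia.
    by rewrite mem_mirror.
  + by apply: IH2 => //; lia.
  + by apply: centred_equi (equi_alpha _ _ _ _ _ _ _) _; apply: IH3 => //; lia.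
  + by apply: centred_equi (equi_alpha _ _ _ _ _ _ _) _; apply: down => //; lia.
- move=> L R [y|a b s] D /=.
    by rewrite inE => _ /eqP[<-]; exists L, R, D; exact: equi_refl.
  rewrite ltnS !mem_cat => lt; case/or3P=> H.
  + by apply: centred_equi (equi_turn _ _ _ _ _ _) _; apply: IH3 => //; lia.
  + by apply: centred_equi (equi_turn2 _ _ _ _ _ _) _; apply: IH3 => //; lia.
  + by apply: centred_equi (equi_turn _ _ _ _ _ _) _; apply: IH1 => //; lia.
Qed.

Lemma centre T : (true, x) \in labels T ->
  exists L R D, equi T (Expansion L R (RedLeaf x) D).
Proof.
case: T => L R U D; rewrite /= !mem_cat; case/or4P=> H.
- by case: (centre_size (blue_size L).+1) => H1 _ _; exact: H1.
- apply: centred_equi (equi_delta _ _ _ _) _.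
  by case: (centre_size (blue_size R).+1) => H1 _ _; exact: H1.
- by case: (centre_size (red_size U).+1) => _ _ H1; exact: H1.
- apply: centred_equi (equi_delta _ _ _ _) _.
  by case: (centre_size (red_size D).+1) => _ _ H1; exact: H1.
Qed.

End Centre.

(** In normal form the edges of a circle are listed one by one, starting at its point
    of attachment, and no circle is strung between it and the previous one. *)
Fixpoint red_normal (t : red) : bool :=
  match t with
  | RedLeaf _ => true
  | RedNode a b s => [&& (if a is RedLeaf _ then true else false),
                         red_normal b & blue_normal s]
  end
with blue_normal (t : blue) : bool :=
  match t with
  | BlueLeaf _ _ => true
  | BlueNode p q u d => [&& (if p is BlueLeaf _ _ then true else false),
      (if u is RedLeaf _ then true else false), blue_normal q & red_normal d]
  end.

(** Each shift takes a circle off the inner part of the blue edge. *)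
Lemma inner_leaf p q u d : exists z fl q' u' d',
  blue_equi (BlueNode p q u d) (BlueNode (BlueLeaf z fl) q' u' d') /\
  blue_size (BlueNode p q u d) = blue_size (BlueNode (BlueLeaf z fl) q' u' d').
Proof.
have [n] := ubnP (blue_size p); elim: n p q u d => // n IH [z fl|p q u d] q' u' d'.
  by move=> _; exists z, fl, q', u', d'; split=> //; exact: blue_equi_refl.
rewrite ltnS => le.
have [|z [fl [q1 [u1 [d1 [E S]]]]]] := IH q (BlueNode (mirror p) q' u' d') d u.
  by move: le => /=; lia.
exists z, fl, q1, u1, d1; split; last by rewrite -S /= mirror_size; lia.
exact: blue_equi_trans (blue_equi_shift _ _ _ _ _ _ _) E.
Qed.

(** Turning the outer circle shortens its upper arc. *)
Lemma arc_leaf p q u d : exists q' x d',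
  blue_equi (BlueNode p q u d) (BlueNode p q' (RedLeaf x) d') /\
  blue_size (BlueNode p q u d) = blue_size (BlueNode p q' (RedLeaf x) d').
Proof.
have [n] := ubnP (red_size u); elim: n q u d => // n IH q [x|a b s] d.
  by move=> _; exists q, x, d; split=> //; exact: blue_equi_refl.
rewrite ltnS => le.
have [|q' [x [d' [E S]]]] := IH s b (RedNode d a q); first by move: le => /=; lia.
exists q', x, d'; split; last by rewrite -S /=; lia.
exact: blue_equi_trans (blue_equi_turn _ _ _ _ _ _) E.
Qed.

(** Reassociation to the right ends with a leaf in front. *)
Lemma half_leaf a b s : exists x b' s',
  red_equi (RedNode a b s) (RedNode (RedLeaf x) b' s') /\
  red_size (RedNode a b s) = red_size (RedNode (RedLeaf x) b' s').
Proof.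
have [n] := ubnP (red_size a); elim: n a b s => // n IH [x|a b s] b' s'.
  by move=> _; exists x, b', s'; split=> //; exact: red_equi_refl.
rewrite ltnS => le.
have [|x [b1 [s1 [E S]]]] := IH a (RedNode b b' s') s; first by move: le => /=; lia.
exists x, b1, s1; split; last by rewrite -S /=; lia.
exact: red_equi_trans (red_equi_assoc _ _ _ _ _) E.
Qed.

Lemma normalise n :
  (forall b, blue_size b < n -> exists2 b', blue_normal b' & blue_equi b b') /\
  (forall r, red_size r < n -> exists2 r', red_normal r' & red_equi r r').
Proof.
elim: n => // n [IHb IHr]; split.
- case=> [z fl|p q u d] lt.
    by exists (BlueLeaf z fl) => //; exact: blue_equi_refl.
  have [z [fl [q1 [u1 [d1 [E1 S1]]]]]] := inner_leaf p q u d.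
  have [q2 [x [d2 [E2 S2]]]] := arc_leaf (BlueLeaf z fl) q1 u1 d1.
  move: lt; rewrite S1 S2 /= => lt.
  have [|q3 nq Eq] := IHb q2; first by lia.
  have [|d3 nd Ed] := IHr d2; first by lia.
  exists (BlueNode (BlueLeaf z fl) q3 (RedLeaf x) d3); first by rewrite /= nq.
  apply: blue_equi_trans E1 _; apply: blue_equi_trans E2 _.
  by apply: blue_equi_node => //; exact: red_equi_refl.
- case=> [x|a b s] lt.
    by exists (RedLeaf x) => //; exact: red_equi_refl.
  have [x [b1 [s1 [E1 S1]]]] := half_leaf a b s.
  move: lt; rewrite S1 /= => lt.
  have [|b2 nb Eb] := IHr b1; first by lia.
  have [|s2 ns Es] := IHb s1; first by lia.
  exists (RedNode (RedLeaf x) b2 s2); first by rewrite /= nb.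
  apply: red_equi_trans E1 _.
  by apply: red_equi_node => //; exact: red_equi_refl.
Qed.

Lemma normal_form x T : (true, x) \in labels T -> exists L R D,
  [/\ blue_normal L, blue_normal R, red_normal D &
      equi T (Expansion L R (RedLeaf x) D)].
Proof.
move=> /centre[L [R [D E]]].
have [L' nL EL] := (normalise (blue_size L).+1).1 L (ltnSn _).
have [R' nR ER] := (normalise (blue_size R).+1).1 R (ltnSn _).
have [D' nD ED] := (normalise (red_size D).+1).2 D (ltnSn _).
exists L', R', D'; split=> //; apply: equi_trans E _.
apply: equi_trans (EL _ _ _) _; apply: equi_trans (blue_equi_right _ _ _ ER) _.
exact: red_equi_down.
Qed.

(** * Normal forms are determined by incidences *)

Lemma grows_red k c : grows k c -> c \in [:: r1; r2] -> k = Red.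
Proof. by case: k; case: c. Qed.

Lemma grows_blue k c : grows k c -> c \in [:: bm; bp] -> k = Blue.
Proof. by case: k; case: c. Qed.

Lemma side_old_new p q k n : p != [::] -> size p = size q -> side p k <> (q, n).
Proof. by move=> p0 sz E; have := size_side k p0; rewrite E sz ltnn. Qed.

(** In a full expansion a vertex is met by at most one red edge starting there, one
    ending there and one blue edge. For new vertices this is read off the replacement
    graphs, and for an old one the edge meeting it descends from the unique one of the
    previous level. *)
Lemma red_side_unique x y b : is_edge x -> is_edge y -> size x = size y ->
  edge_colour x = Red -> edge_colour y = Red -> side x b = side y b -> x = y.
Proof.
elim/last_ind: x y b => // p c IH y b.
case/lastP: y => // q c' ; rewrite !size_rcons => + + [sz].
have [p0|p0] := eqVneq p [::].
  move: sz; rewrite p0 => /esym/size0nil ->.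
  by rewrite !edge_colour_rcons; case: c => //; case: c' => // _ _ _ _; case: b.
have q0 : q != [::] by rewrite -size_eq0 -sz size_eq0.
rewrite !is_edge_rcons // !edge_colour_rcons.
move=> /andP[ep gp] /andP[eq_ gq] cr cr' E.
suff [-> ->] : p = q /\ c = c' by [].
have N k n : side p k <> (q, n) by exact: side_old_new.
have N' k n : (p, n) <> side q k.
  by move=> H; apply: (@side_old_new q p k n) => //; rewrite -?sz.
have I k : c \in [:: r1; r2] -> c' \in [:: r1; r2] -> side p k = side q k -> p = q.
  by move=> /(grows_red gp) Cp /(grows_red gq) Cq; exact: IH.
have {}I := I b; move: E; rewrite !side_rcons.
by case: c cr gp I => // _ _; case: c' cr' gq => // _ _ I; case: b I => /= I E;
  first [by case: E => -> | by split=> //; exact: I |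
    case: (N false _ E) | case: (N true _ E) | case: (N' false _ E) | case: (N' true _ E)].
Qed.

Lemma blue_side_unique x y b b' : is_edge x -> is_edge y -> size x = size y ->
  edge_colour x = Blue -> edge_colour y = Blue -> side x b = side y b' ->
  x = y /\ b = b'.
Proof.
elim/last_ind: x y b b' => // p c IH y b b'.
case/lastP: y => // q c' ; rewrite !size_rcons => + + [sz].
have [p0|p0] := eqVneq p [::].
  move: sz; rewrite p0 => /esym/size0nil ->.
  by rewrite !edge_colour_rcons; case: c => //; case: c' => // _ _ _ _;
    case: b; case: b'.
have q0 : q != [::] by rewrite -size_eq0 -sz size_eq0.
rewrite !is_edge_rcons // !edge_colour_rcons.
move=> /andP[ep gp] /andP[eq_ gq] cr cr' E.
have N k n : side p k <> (q, n) by exact: side_old_new.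
have N' k n : (p, n) <> side q k.
  by move=> H; apply: (@side_old_new q p k n) => //; rewrite -?sz.
have I k k' : c \in [:: bm; bp] -> c' \in [:: bm; bp] -> side p k = side q k' ->
    p = q /\ k = k'.
  by move=> /(grows_blue gp) Cp /(grows_blue gq) Cq; exact: IH.
move: E; rewrite !side_rcons.
by case: c cr gp I => // _ _; case: c' cr' gq => // _ _ I;
  case: b; case: b' => /= E;
  first [by case: E => -> | by case: (I false false isT isT E) => -> |
    by case: (I true true isT isT E) => -> |
    by case: (I false true isT isT E) | by case: (I true false isT isT E) |
    case: (N false _ E) | case: (N true _ E) | case: (N' false _ E) | case: (N' true _ E)].
Qed.

(** ** The vertices at the ends of a labelled tree *)

Fixpoint first_edge (t : red) : word :=
  match t with RedLeaf x => x | RedNode a _ _ => first_edge a end.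

Fixpoint last_edge (t : red) : word :=
  match t with RedLeaf x => x | RedNode _ b _ => last_edge b end.

(** The label found at the terminal vertex of the cell, with the end at which the
    cell of that label meets it. *)
Fixpoint terminal (t : blue) : word * bool :=
  match t with BlueLeaf z fl => (z, ~~ fl) | BlueNode _ q _ _ => terminal q end.

(** The inner edge of a blue edge ends at its initial vertex. *)
Definition initial (t : blue) : word * bool :=
  match t with BlueLeaf z fl => (z, fl) | BlueNode p _ _ _ => terminal p end.

Lemma end_pt_rcons e c b b' : is_edge e -> grows (edge_colour e) c ->
  side (rcons e c) b = side e b' -> end_pt (rcons e c) b = end_pt e b'.
Proof.
move=> ee gr E; apply/end_pt_eq => //.
by rewrite is_edge_rcons ?is_edge_nil // ee.
Qed.

Lemma reversed_end_pt h z w b : reversed_on h z w ->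
  h (end_pt z b) = end_pt w (~~ b).
Proof.
move=> H; have [ez ew Cz Cw] := reversed_edge H.
case: H => H1 H2 _ _; case: b => /=.
- rewrite -(@end_pt_rcons z bp true) ?Cz ?side_rcons //.
  by rewrite (canonical_end_pt _ H2); apply: end_pt_rcons; rewrite ?Cw ?side_rcons.
- rewrite -(@end_pt_rcons z bm true) ?Cz ?side_rcons //.
  by rewrite (canonical_end_pt _ H1); apply: end_pt_rcons; rewrite ?Cw ?side_rcons.
Qed.

Lemma carries_end_pt h fl z w b : carries h fl z w ->
  h (end_pt z b) = end_pt w (fl (+) b).
Proof.
by case: fl => [/reversed_end_pt->|/canonical_end_pt->].
Qed.

Definition red_cell w := is_edge w /\ edge_colour w = Red.
Definition blue_cell w := is_edge w /\ edge_colour w = Blue.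

Lemma cell_r1 w : red_cell w -> red_cell (rcons w r1).
Proof.
by move=> [ew C]; split; rewrite ?edge_colour_rcons ?is_edge_rcons ?is_edge_nil // ew C.
Qed.

Lemma cell_r2 w : red_cell w -> red_cell (rcons w r2).
Proof.
by move=> [ew C]; split; rewrite ?edge_colour_rcons ?is_edge_rcons ?is_edge_nil // ew C.
Qed.

Lemma cell_es w : red_cell w -> blue_cell (rcons w es).
Proof.
by move=> [ew C]; split; rewrite ?edge_colour_rcons ?is_edge_rcons ?is_edge_nil // ew C.
Qed.

Lemma cell_bm w : blue_cell w -> blue_cell (rcons w bm).
Proof.
by move=> [ew C]; split; rewrite ?edge_colour_rcons ?is_edge_rcons ?is_edge_nil // ew C.
Qed.

Lemma cell_bp w : blue_cell w -> blue_cell (rcons w bp).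
Proof.
by move=> [ew C]; split; rewrite ?edge_colour_rcons ?is_edge_rcons ?is_edge_nil // ew C.
Qed.

Lemma cell_eu w : blue_cell w -> red_cell (rcons w eu).
Proof.
by move=> [ew C]; split; rewrite ?edge_colour_rcons ?is_edge_rcons ?is_edge_nil // ew C.
Qed.

Lemma cell_ed w : blue_cell w -> red_cell (rcons w ed).
Proof.
by move=> [ew C]; split; rewrite ?edge_colour_rcons ?is_edge_rcons ?is_edge_nil // ew C.
Qed.

Lemma first_edge_pt h w t : red_cell w -> red_at h w t ->
  h (end_pt (first_edge t) false) = end_pt w false.
Proof.
elim: t w => [x w _ /canonical_end_pt->//|a IH b _ s w cw [Ha _ _] /=].
rewrite (IH _ (cell_r1 cw) Ha); case: cw => ew C.
by apply: end_pt_rcons; rewrite ?C ?side_rcons.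
Qed.

Lemma last_edge_pt h w t : red_cell w -> red_at h w t ->
  h (end_pt (last_edge t) true) = end_pt w true.
Proof.
elim: t w => [x w _ /canonical_end_pt->//|a _ b IH s w cw [_ Hb _] /=].
rewrite (IH _ (cell_r2 cw) Hb); case: cw => ew C.
by apply: end_pt_rcons; rewrite ?C ?side_rcons.
Qed.

Lemma terminal_pt h w t : blue_cell w -> blue_at h w t ->
  h (end_pt (terminal t).1 (terminal t).2) = end_pt w true.
Proof.
elim: t w => [z fl w _ /= /carries_end_pt->|p _ q IH u d w cw [_ Hq _ _] /=].
  by case: fl.
rewrite (IH _ (cell_bp cw) Hq); case: cw => ew C.
by apply: end_pt_rcons; rewrite ?C ?side_rcons.
Qed.

Lemma initial_pt h w t : blue_cell w -> blue_at h w t ->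
  h (end_pt (initial t).1 (initial t).2) = end_pt w false.
Proof.
case: t => [z fl _ /= /carries_end_pt->|p q u d cw [Hp _ _ _] /=].
  by case: fl.
rewrite (terminal_pt (cell_bm cw) Hp); case: cw => ew C.
by apply: end_pt_rcons; rewrite ?C ?side_rcons.
Qed.

Lemma midpoint w : red_cell w ->
  end_pt (rcons w r1) true = end_pt (rcons w r2) false /\
  end_pt (rcons w es) false = end_pt (rcons w r2) false.
Proof.
move=> cw; have [e1 _] := cell_r1 cw.
have [e2 _] := cell_r2 cw.
have [e3 _] := cell_es cw.
by split; apply/end_pt_eq; rewrite ?side_rcons.
Qed.

Lemma circle_vertices w : blue_cell w ->
  [/\ end_pt (rcons w bm) false = end_pt (rcons w eu) true,
      end_pt (rcons w ed) false = end_pt (rcons w eu) true,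
      end_pt (rcons w bp) false = end_pt (rcons w eu) false &
      end_pt (rcons w ed) true = end_pt (rcons w eu) false].
Proof.
move=> cw; have [e1 _] := cell_bm cw.
have [e2 _] := cell_bp cw.
have [e3 _] := cell_eu cw.
have [e4 _] := cell_ed cw.
by split; apply/end_pt_eq; rewrite ?side_rcons.
Qed.

(** The blue cells placed outwards: the terminal vertex is a tip of the figure, not a
    vertex of a circle. *)
Definition tip_cell w := blue_cell w /\ tip_name (side w true).2.

Lemma tip_cell_rcons w : tip_cell w -> tip_cell (rcons w bp).
Proof.
by move=> [cw tw]; split; [exact: cell_bp|rewrite side_rcons].
Qed.

Lemma tip_cell_spike w : red_cell w -> tip_cell (rcons w es).
Proof. by move=> cw; split; [exact: cell_es|rewrite side_rcons]. Qed.

Lemma first_edge_label t : (true, first_edge t) \in red_labels t.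
Proof. by elim: t => //= x; rewrite ?mem_head // => H *; rewrite mem_cat H. Qed.

Lemma last_edge_label t : (true, last_edge t) \in red_labels t.
Proof.
by elim: t => [x|a _ b H s] /=; rewrite ?mem_head // !mem_cat H orbT.
Qed.

Lemma terminal_label t : (false, (terminal t).1) \in blue_labels t.
Proof.
by elim: t => [z fl|p _ q H u d] /=; rewrite ?mem_head // !mem_cat H orbT.
Qed.

Lemma initial_label t : (false, (initial t).1) \in blue_labels t.
Proof.
by case: t => [z fl|p q u d] /=; rewrite ?mem_head // !mem_cat terminal_label.
Qed.

Lemma red_label_colour h t : forall w, red_cell w -> red_at h w t ->
  edge_colour (first_edge t) = Red /\ edge_colour (last_edge t) = Red.
Proof.
elim: t => [x w [_ C] /=|a IHa b IHb s w cw [/= Ha Hb _]].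
  by case=> _ _ ->.
by have [-> _] := IHa _ (cell_r1 cw) Ha;
   have [_ ->] := IHb _ (cell_r2 cw) Hb.
Qed.

Lemma terminal_colour h t : forall w, blue_cell w -> blue_at h w t ->
  edge_colour (terminal t).1 = Blue.
Proof.
elim: t => [z fl w [_ C] /= /carries_edge[_ _ ->]//|p _ q IH u d w cw [_ Hq _ _] /=].
exact: IH (cell_bp cw) Hq.
Qed.

Lemma initial_colour h t w : blue_cell w -> blue_at h w t ->
  edge_colour (initial t).1 = Blue.
Proof.
case: t => [z fl [_ C] /= /carries_edge[_ _ ->]//|p q u d cw [Hp _ _ _] /=].
exact: terminal_colour (cell_bm cw) Hp.
Qed.

Section Uniqueness.
Variable N : nat.

Definition sized (l : bool * word) : bool := is_edge l.2 && (size l.2 == N.+1).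

(** The second condition serves to recognise a tip in the image: no red cell ends
    there. *)
Definition spread (h : Airplane -> Airplane) : Prop :=
  injective h /\ forall x, is_edge x -> size x = N.+1 -> edge_colour x = Red ->
    exists w, canonical_on h x w.

Lemma sized_side (h : Airplane -> Airplane) x y b b' : injective h -> sized x -> sized y ->
  h (end_pt x.2 b) = h (end_pt y.2 b') -> side x.2 b = side y.2 b'.
Proof.
by move=> hI /andP[ex _] /andP[ey _] /hI E; exact: (end_pt_eq b b' ex ey).1 E.
Qed.

(** A leaf is told from a subdivided edge with the same first and last label, since
    the midpoint of a subdivided edge is not its terminal vertex. *)
Lemma leaf_comb (h : Airplane -> Airplane) w x b s : injective h -> red_cell w ->
  red_at h w (RedNode (RedLeaf x) b s) -> last_edge b <> x.
Proof.
move=> hI cw [Hx Hb _] bx.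
have H1 := canonical_end_pt true Hx.
have := last_edge_pt (cell_r2 cw) Hb.
have [e1 _] := cell_r1 cw.
have [e2 _] := cell_r2 cw.
rewrite bx H1 => /end_pt_eq -/(_ e1 e2); rewrite !side_rcons /=.
by move/esym; apply: (@side_new w true); apply: is_edge_nil; case: cw.
Qed.

(** A leaf at a tip is told from a subdivided edge: the far end of its label would be
    a tip for one map, and lie on a red edge for the other one. *)
Lemma leaf_circle (h1 h2 : Airplane -> Airplane) w1 w2 z fl q x d : spread h1 -> injective h2 ->
  tip_cell w1 -> blue_cell w2 -> sized (false, z) -> sized (true, x) ->
  carries h1 fl z w1 ->
  ~ blue_at h2 w2 (BlueNode (BlueLeaf z (~~ fl)) q (RedLeaf x) d).
Proof.
move=> [hI hS] h2I [cw1 tw1] cw2 sz sx Hz [Hz' _ Hx _].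
have [V1 _ _ _] := circle_vertices cw2.
have E2 : h2 (end_pt z (~~ fl)) = h2 (end_pt x true).
  by rewrite (carries_end_pt _ Hz') (canonical_end_pt _ Hx) addbb.
have zx := sized_side h2I sz sx E2.
have [ex Sx] := andP sx.
have Cx : edge_colour x = Red.
  have [_ C] := cell_eu cw2.
  by case: Hx => _ _ ->.
have [w hw] := hS x ex (eqP Sx) Cx; have [_ ew Cw _] := hw.
have := carries_end_pt (~~ fl) Hz; rewrite addbN addbb /=.
have [ez _] := andP sz; have -> : end_pt z (~~ fl) = end_pt x true by apply/end_pt_eq.
rewrite (canonical_end_pt _ hw) => /end_pt_eq; case: cw1 => ew1 _ => /(_ ew ew1) E.
have := red_side_not_tip true ew; rewrite -Cw Cx E tw1.
by move=> /(_ erefl).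
Qed.

Variables h1 h2 : Airplane -> Airplane.
Hypotheses (spread1 : spread h1) (spread2 : spread h2).

(** A normal form is recovered from incidences between its labels. The terminal
    vertex of a red leaf determines the next red label of the circle and the blue
    label attached there; the walk along a circle stops at the prescribed last
    label, and a branch of the tree stops at a tip. *)
Lemma normal_unique n :
  (forall a1 a2 w1 w2, red_size a1 < n -> red_normal a1 -> red_normal a2 ->
     all sized (red_labels a1) -> all sized (red_labels a2) ->
     red_cell w1 -> red_cell w2 -> red_at h1 w1 a1 -> red_at h2 w2 a2 ->
     first_edge a1 = first_edge a2 -> last_edge a1 = last_edge a2 -> a1 = a2) /\
  (forall b1 b2 w1 w2, blue_size b1 < n -> blue_normal b1 -> blue_normal b2 ->
     all sized (blue_labels b1) -> all sized (blue_labels b2) ->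
     tip_cell w1 -> tip_cell w2 -> blue_at h1 w1 b1 -> blue_at h2 w2 b2 ->
     initial b1 = initial b2 -> b1 = b2).
Proof.
have [I1 _] := spread1; have [I2 _] := spread2.
elim: n => [//|n [IHr IHb]]; split.
- case=> [x1|[x1|//] c1 s1] [x2|[x2|//] c2 s2] w1 w2 //=.
  + by move=> _ _ _ _ _ _ _ _ _ ->.
  + move=> _ _ _ _ _ _ cw2 _ H xx /esym E; subst x2.
    by case: (leaf_comb I2 cw2 H E).
  + move=> _ _ _ _ _ cw1 _ H _ xx E; subst x2.
    by case: (leaf_comb I1 cw1 H E).
  rewrite !all_cat ltnS => le /andP[nc1 ns1] /andP[nc2 ns2].
  move=> /and3P[sx1 lc1 ls1] /and3P[sx2 lc2 ls2] cw1 cw2.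
  move=> [Hx1 Hc1 Hs1] [Hx2 Hc2 Hs2] xx cc; subst x2.
  have [M1 M1'] := midpoint cw1; have [M2 M2'] := midpoint cw2.
  have cwr1 := cell_r2 cw1.
  have cwr2 := cell_r2 cw2.
  have lf1 := allP lc1 _ (first_edge_label _).
  have lf2 := allP lc2 _ (first_edge_label _).
  have li1 := allP ls1 _ (initial_label _).
  have li2 := allP ls2 _ (initial_label _).
  have E1 : side x1 true = side (first_edge c1) false.
    apply: (sized_side I1 sx1 lf1).
    by rewrite (canonical_end_pt _ Hx1) (first_edge_pt cwr1 Hc1).
  have E2 : side x1 true = side (first_edge c2) false.
    apply: (sized_side I2 sx2 lf2).
    by rewrite (canonical_end_pt _ Hx2) (first_edge_pt cwr2 Hc2).
  have F1 : side x1 true = side (initial s1).1 (initial s1).2.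
    apply: (sized_side I1 sx1 li1).
    by rewrite (canonical_end_pt _ Hx1) (initial_pt (cell_es cw1) Hs1) M1.
  have F2 : side x1 true = side (initial s2).1 (initial s2).2.
    apply: (sized_side I2 sx2 li2).
    by rewrite (canonical_end_pt _ Hx2) (initial_pt (cell_es cw2) Hs2) M2.
  have [ef1 /eqP sf1] := andP lf1; have [ef2 /eqP sf2] := andP lf2.
  have [ei1 /eqP si1] := andP li1; have [ei2 /eqP si2] := andP li2.
  have ff : first_edge c1 = first_edge c2.
    apply: (@red_side_unique _ _ false) => //; rewrite ?sf1 ?sf2 -?E1 -?E2 //.
    - by case: (red_label_colour cwr1 Hc1).
    - by case: (red_label_colour cwr2 Hc2).
  have ii : initial s1 = initial s2.
    rewrite [LHS]surjective_pairing [RHS]surjective_pairing.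
    suff [-> ->] : (initial s1).1 = (initial s2).1 /\ (initial s1).2 = (initial s2).2 by [].
    apply: blue_side_unique => //; last by rewrite -F1 -F2.
    + by rewrite si1 si2.
    + exact: initial_colour (cell_es cw1) Hs1.
    + exact: initial_colour (cell_es cw2) Hs2.
  congr RedNode.
  + apply: IHr nc1 nc2 lc1 lc2 cwr1 cwr2 Hc1 Hc2 ff cc.
    by clear - le; lia.
  + apply: IHb ns1 ns2 ls1 ls2 (tip_cell_spike cw1) (tip_cell_spike cw2) Hs1 Hs2 ii.
    by clear - le; lia.
case=> [z1 f1|[z1 f1|//] q1 [x1|//] d1] [z2 f2|[z2 f2|//] q2 [x2|//] d2] w1 w2 //=.
- by move=> _ _ _ _ _ _ _ _ _ [-> ->].
- move=> _ _ _ /andP[sz1 _]; rewrite all_cat.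
  move=> /and3P[_ _ /andP[sx2 _]] cw1 [cw2 _] H1 H2 [zz ff]; subst z2 f1.
  exfalso; apply: (leaf_circle spread1 I2 cw1 cw2 sz1 sx2 H1 (q := q2) (d := d2)).
  by rewrite negbK; exact: H2.
- move=> _ _ _; rewrite all_cat => /and3P[_ _ /andP[sx1 _]].
  move=> /andP[sz2 _] [cw1 _] cw2 H1 H2 [zz ff]; subst z2 f2.
  exfalso; apply: (leaf_circle spread2 I1 cw2 cw1 sz2 sx1 H2 (q := q1) (d := d1)).
  by rewrite negbK; exact: H1.
rewrite !all_cat ltnS => le /andP[nq1 nd1] /andP[nq2 nd2].
move=> /and4P[sz1 lq1 sx1 ld1] /and4P[sz2 lq2 sx2 ld2] tw1 tw2.
move=> [Hz1 Hq1 Hx1 Hd1] [Hz2 Hq2 Hx2 Hd2] [zz /negb_inj ff]; subst z2 f2.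
have [cw1 _] := tw1; have [cw2 _] := tw2.
have [V1 V1' W1 W1'] := circle_vertices cw1.
have [V2 V2' W2 W2'] := circle_vertices cw2.
have cd1 := cell_ed cw1.
have cd2 := cell_ed cw2.
have cq1 := cell_bp cw1.
have cq2 := cell_bp cw2.
have [ex1 /eqP Sx1] := andP sx1; have [ex2 /eqP Sx2] := andP sx2.
have red_arc w x h : blue_cell w -> canonical_on h x (rcons w eu) -> edge_colour x = Red.
  by move=> /cell_eu[_ C] [_ _ -> _].
have Cx1 := red_arc _ _ _ cw1 Hx1; have Cx2 := red_arc _ _ _ cw2 Hx2.
have xx : x1 = x2.
  apply: (@red_side_unique _ _ true) => //; first by rewrite Sx1 Sx2.
  transitivity (side z1 f1).
    apply/esym/(sized_side I1 sz1 sx1).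
    by rewrite (carries_end_pt _ Hz1) (canonical_end_pt _ Hx1) addbb.
  apply: (sized_side I2 sz2 sx2).
  by rewrite (carries_end_pt _ Hz2) (canonical_end_pt _ Hx2) addbb.
subst x2.
have lf1 := allP ld1 _ (first_edge_label _); have lf2 := allP ld2 _ (first_edge_label _).
have ll1 := allP ld1 _ (last_edge_label _); have ll2 := allP ld2 _ (last_edge_label _).
have li1 := allP lq1 _ (initial_label _); have li2 := allP lq2 _ (initial_label _).
have E1 : side x1 true = side (first_edge d1) false.
  apply: (sized_side I1 sx1 lf1).
  by rewrite (canonical_end_pt _ Hx1) (first_edge_pt cd1 Hd1).
have E2 : side x1 true = side (first_edge d2) false.
  apply: (sized_side I2 sx2 lf2).
  by rewrite (canonical_end_pt _ Hx2) (first_edge_pt cd2 Hd2).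
have L1 : side x1 false = side (last_edge d1) true.
  apply: (sized_side I1 sx1 ll1).
  by rewrite (canonical_end_pt _ Hx1) (last_edge_pt cd1 Hd1).
have L2 : side x1 false = side (last_edge d2) true.
  apply: (sized_side I2 sx2 ll2).
  by rewrite (canonical_end_pt _ Hx2) (last_edge_pt cd2 Hd2).
have F1 : side x1 false = side (initial q1).1 (initial q1).2.
  apply: (sized_side I1 sx1 li1).
  by rewrite (canonical_end_pt _ Hx1) (initial_pt cq1 Hq1).
have F2 : side x1 false = side (initial q2).1 (initial q2).2.
  apply: (sized_side I2 sx2 li2).
  by rewrite (canonical_end_pt _ Hx2) (initial_pt cq2 Hq2).
have [ef1 /eqP sf1] := andP lf1; have [ef2 /eqP sf2] := andP lf2.
have [el1 /eqP sl1] := andP ll1; have [el2 /eqP sl2] := andP ll2.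
have [ei1 /eqP si1] := andP li1; have [ei2 /eqP si2] := andP li2.
have [Cf1 Cl1] := red_label_colour cd1 Hd1; have [Cf2 Cl2] := red_label_colour cd2 Hd2.
congr BlueNode.
- have lt : blue_size q1 < n by clear - le; lia.
  apply: (IHb _ _ _ _ lt nq1 nq2 lq1 lq2 (tip_cell_rcons tw1) (tip_cell_rcons tw2) Hq1 Hq2).
  rewrite [LHS]surjective_pairing [RHS]surjective_pairing.
  suff [-> ->] : (initial q1).1 = (initial q2).1 /\ (initial q1).2 = (initial q2).2 by [].
  apply: blue_side_unique => //; last by rewrite -F1 -F2.
  + by rewrite si1 si2.
  + exact: initial_colour cq1 Hq1.
  + exact: initial_colour cq2 Hq2.
- have lt : red_size d1 < n by clear - le; lia.
  apply: (IHr _ _ _ _ lt nd1 nd2 ld1 ld2 cd1 cd2 Hd1 Hd2).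
  + by apply: (@red_side_unique _ _ false); rewrite ?sf1 ?sf2 -?E1 -?E2.
  + by apply: (@red_side_unique _ _ true); rewrite ?sl1 ?sl2 -?L1 -?L2.
Qed.

End Uniqueness.

(** * Generation *)

(** A subdivision of the limit space into the cells [p] with [stop p] is the set of
    leaves of an expansion, in which they are given the labels [lab p]. *)
Section Build.
Variables (stop : pred word) (lab : word -> word).

Fixpoint build_red (n : nat) (w : word) : red :=
  if n is m.+1 then
    if stop w then RedLeaf (lab w) else
    RedNode (build_red m (rcons w r1)) (build_red m (rcons w r2))
            (build_blue m (rcons w es))
  else RedLeaf (lab w)
with build_blue (n : nat) (w : word) : blue :=
  if n is m.+1 then
    if stop w then BlueLeaf (lab w) false else
    BlueNode (build_blue m (rcons w bm)) (build_blue m (rcons w bp))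
             (build_red m (rcons w eu)) (build_red m (rcons w ed))
  else BlueLeaf (lab w) false.

Definition build (n : nat) : expansion :=
  Expansion (build_blue n [:: eL]) (build_blue n [:: eR])
            (build_red n [:: eU]) (build_red n [:: eD]).

Variables (M N : nat) (h : Airplane -> Airplane).
Hypothesis stop_bar : forall e, is_edge e -> size e = M ->
  exists2 p, stop p & prefix p e.
Hypothesis stop_antichain : forall p q, stop p -> stop q -> prefix p q -> p = q.
Hypothesis stop_lab : forall p, stop p -> canonical_on h (lab p) p.
Hypothesis stop_sized : forall p, stop p -> size (lab p) = N.+1.

Let tag (e : word) : bool := if edge_colour e is Red then true else false.

Let fresh w := forall p, stop p -> prefix p w -> p = w.

Let fresh_rcons w c : fresh w -> ~~ stop w -> fresh (rcons w c).
Proof.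
move=> fw nw p sp /prefixP[s]; case/lastP: s => [|s d]; first by rewrite cats0.
rewrite -rcons_cat => /rcons_inj[E _].
have pw : p = w by apply: fw => //; rewrite E prefix_prefix.
by move: nw; rewrite -pw sp.
Qed.

Let stop_bottom w : is_edge w -> fresh w -> size w = M -> stop w.
Proof.
by move=> ew fw /(stop_bar ew)[p sp /(fw p sp)<-].
Qed.

Let lab_leaf w : is_edge w -> stop w ->
  canonical_on h (lab w) w /\ sized N (tag w, lab w).
Proof.
move=> ew sw; have H := stop_lab sw; split=> //.
by rewrite /sized /= stop_sized // eqxx andbT; case: H.
Qed.

Let tag_lab v : stop v -> tag (lab v) = tag v.
Proof. by move=> /stop_lab[_ _ C _]; rewrite /tag C. Qed.

Let next v w : is_edge w -> ~~ stop w -> stop v -> prefix w v ->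
  exists2 c, grows (edge_colour w) c & prefix (rcons w c) v.
Proof.
move=> ew nw sv /prefixP[[|c s] E].
  by move: nw; rewrite E cats0 in sv; rewrite sv.
exists c; last by rewrite E -cat_rcons prefix_prefix.
have [_ ev _ _] := stop_lab sv; rewrite E -cat_rcons in ev.
have r0 : rcons w c != [::] by case: (w).
have := is_edge_prefix r0 ev.
by rewrite is_edge_rcons ?is_edge_nil // => /andP[].
Qed.

(** [fresh w] makes a descent from the root stop exactly at the cells of [stop]; the
   fuel is the number of letters left before [stop_bar] applies. *)
Lemma build_spec n w : is_edge w -> fresh w -> size w + n = M ->
  (edge_colour w = Red ->
     [/\ red_at h w (build_red n w), all (sized N) (red_labels (build_red n w)) &
       forall v, stop v -> prefix w v ->
         (tag (lab v), lab v) \in red_labels (build_red n w)]) /\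
  (edge_colour w = Blue ->
     [/\ blue_at h w (build_blue n w), all (sized N) (blue_labels (build_blue n w)) &
       forall v, stop v -> prefix w v ->
         (tag (lab v), lab v) \in blue_labels (build_blue n w)]).
Proof.
have leaf u : is_edge u -> stop u ->
  (edge_colour u = Red ->
     [/\ red_at h u (RedLeaf (lab u)), all (sized N) (red_labels (RedLeaf (lab u))) &
       forall v, stop v -> prefix u v ->
         (tag (lab v), lab v) \in red_labels (RedLeaf (lab u))]) /\
  (edge_colour u = Blue ->
     [/\ blue_at h u (BlueLeaf (lab u) false),
         all (sized N) (blue_labels (BlueLeaf (lab u) false)) &
       forall v, stop v -> prefix u v ->
         (tag (lab v), lab v) \in blue_labels (BlueLeaf (lab u) false)]).
  move=> eu su; have [H sz] := lab_leaf eu su.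
  by split=> C; (split; [exact: H|by rewrite /= -?C andbT; exact: sz|]);
    move=> v sv /(stop_antichain su sv) <-; rewrite tag_lab // /tag C /= inE.
elim: n w => [|n IH] w ew fw.
  by rewrite addn0 => sz; apply: leaf => //; exact: stop_bottom.
rewrite addnS => sz /=; case: ifP => [sw|/negbT nw]; first exact: leaf.
have ec c : grows (edge_colour w) c -> is_edge (rcons w c).
  by move=> gr; rewrite is_edge_rcons ?is_edge_nil // ew.
have K c : size (rcons w c) + n = M by rewrite size_rcons addSn.
have {}IH c (gr : grows (edge_colour w) c) :=
  IH (rcons w c) (ec c gr) (fresh_rcons fw nw) (K c).
split=> C; rewrite C in IH.
- have [/(_ (edge_colour_rcons _ _))[Ha La Va] _] := IH r1 isT.
  have [/(_ (edge_colour_rcons _ _))[Hb Lb Vb] _] := IH r2 isT.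
  have [_ /(_ (edge_colour_rcons _ _))[Hs Ls Vs]] := IH es isT.
  split=> //; first by rewrite /= !all_cat La Lb Ls.
  move=> v sv /(next ew nw sv)[c]; rewrite C => gr pv; rewrite /= !mem_cat.
  move: gr pv; rewrite /grows !inE => /or3P[] /eqP-> pv.
  + by rewrite Va.
  + by rewrite Vb ?orbT.
  + by rewrite Vs ?orbT.
- have [_ /(_ (edge_colour_rcons _ _))[Hp Lp Vp]] := IH bm isT.
  have [_ /(_ (edge_colour_rcons _ _))[Hq Lq Vq]] := IH bp isT.
  have [/(_ (edge_colour_rcons _ _))[Hu Lu Vu] _] := IH eu isT.
  have [/(_ (edge_colour_rcons _ _))[Hd Ld Vd] _] := IH ed isT.
  split=> //; first by rewrite /= !all_cat Lp Lq Lu Ld.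
  move=> v sv /(next ew nw sv)[c]; rewrite C => gr pv; rewrite /= !mem_cat.
  move: gr pv; rewrite /grows !inE => /or4P[] /eqP-> pv.
  + by rewrite Vp.
  + by rewrite Vq ?orbT.
  + by rewrite Vu ?orbT.
  + by rewrite Vd ?orbT.
Qed.

Lemma build_describes n : M = n.+1 ->
  [/\ describes h (build n), all (sized N) (labels (build n)) &
      forall v, stop v -> (tag (lab v), lab v) \in labels (build n)].
Proof.
move=> Mn.
have fresh1 c : c \in base_graph -> fresh [:: c].
  move=> cb p /stop_lab[_ ep _ _]; rewrite prefixs1 => /orP[] /eqP // pE.
  by rewrite pE in ep.
have B c : c \in base_graph -> is_edge [:: c] by move=> cb; rewrite /= cb.
have S (c : letter) : size [:: c] + n = M by rewrite Mn.
have [_ /(_ erefl)[HL LL VL]] := build_spec (B eL isT) (fresh1 eL isT) (S eL).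
have [_ /(_ erefl)[HR LR VR]] := build_spec (B eR isT) (fresh1 eR isT) (S eR).
have [/(_ erefl)[HU LU VU] _] := build_spec (B eU isT) (fresh1 eU isT) (S eU).
have [/(_ erefl)[HD LD VD] _] := build_spec (B eD isT) (fresh1 eD isT) (S eD).
split=> //; first by rewrite /= !all_cat LL LR LU LD.
move=> v sv; have [_ ev _ _] := stop_lab sv; rewrite /= !mem_cat.
case: v ev sv => // c v /= /andP[+ _] sv.
rewrite !inE => /or4P[] /eqP cE; rewrite cE in sv *.
- by rewrite VL ?prefix_cons ?eqxx ?prefix0s.
- by rewrite VR ?orbT //= prefix0s.
- by rewrite VU ?orbT //= prefix0s.
- by rewrite VD ?orbT //= prefix0s.
Qed.

End Build.

(** ** Maps described by the same expansion *)

(** The places and orientations of labels depend on the tree only, so two maps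
    described by the same tree treat a label in the same way. *)
Lemma leaf_of h1 h2 l :
  (forall t w, red_at h1 w t -> red_at h2 w t -> l \in red_labels t ->
     exists fl v, [/\ carries h1 fl l.2 v, carries h2 fl l.2 v & l.1 -> ~~ fl]) /\
  (forall t w, blue_at h1 w t -> blue_at h2 w t -> l \in blue_labels t ->
     exists fl v, [/\ carries h1 fl l.2 v, carries h2 fl l.2 v & l.1 -> ~~ fl]).
Proof.
apply: tree_ind => [x|a Ha b Hb s Hs|z fl|p Hp q Hq u Hu d Hd] w /=.
- by move=> H1 H2; rewrite inE => /eqP->; exists false, w.
- move=> [A1 B1 S1] [A2 B2 S2]; rewrite !mem_cat => /or3P[].
  + exact: Ha A1 A2.
  + exact: Hb B1 B2.
  + exact: Hs S1 S2.
- by move=> H1 H2; rewrite inE => /eqP->; exists fl, w.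
- move=> [P1 Q1 U1 D1] [P2 Q2 U2 D2]; rewrite !mem_cat => /or4P[].
  + exact: Hp P1 P2.
  + exact: Hq Q1 Q2.
  + exact: Hu U1 U2.
  + exact: Hd D1 D2.
Qed.

Lemma describes_leaf h1 h2 T l : describes h1 T -> describes h2 T -> l \in labels T ->
  exists fl v, [/\ carries h1 fl l.2 v, carries h2 fl l.2 v & l.1 -> ~~ fl].
Proof.
case: T => L R U D [L1 R1 U1 D1] [L2 R2 U2 D2]; rewrite /= !mem_cat => /or4P[].
- exact: (leaf_of h1 h2 l).2 L1 L2.
- exact: (leaf_of h1 h2 l).2 R1 R2.
- exact: (leaf_of h1 h2 l).1 U1 U2.
- exact: (leaf_of h1 h2 l).1 D1 D2.
Qed.

Lemma canonical_agree h1 h2 e v w : canonical_on h1 e v -> canonical_on h2 e v ->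
  Omega (prepend e w) -> h1 (pt (prepend e w)) = h2 (pt (prepend e w)).
Proof.
by move=> /canonicalP[_ _ _ H1] /canonicalP[_ _ _ H2] Ow; rewrite H1 // H2.
Qed.

Lemma carries_agree h1 h2 fl e v w : carries h1 fl e v -> carries h2 fl e v ->
  Omega (prepend e w) -> h1 (pt (prepend e w)) = h2 (pt (prepend e w)).
Proof.
case: fl; last exact: canonical_agree.
move=> H1; have [ee _ C _] := reversed_edge H1.
move: H1 => [A1 A2 A3 A4] [B1 B2 B3 B4] Ow.
have : grows (edge_colour e) (w 0).
  have /(_ 1) := (Omega_prepend w ee).1 Ow.
  by rewrite cats1 is_edge_rcons ?is_edge_nil // => /andP[].
have wE : prepend e w = prepend (rcons e (w 0)) (fun n => w n.+1).
  by rewrite prepend_rcons prepend1.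
rewrite C wE in Ow *; rewrite /grows !inE => /or4P[] /eqP c0; rewrite c0 in Ow *.
- exact: canonical_agree A1 B1 Ow.
- exact: canonical_agree A2 B2 Ow.
- exact: canonical_agree A3 B3 Ow.
- exact: canonical_agree A4 B4 Ow.
Qed.

(** The labels cover the source, so an expansion bearing all of them leaves no
    freedom for the map. *)
Lemma describes_inj N h1 h2 T : describes h1 T -> describes h2 T ->
  (forall e, e \in level N -> exists b, (b, e) \in labels T) -> h1 = h2.
Proof.
move=> H1 H2 HT; apply/funext => a; have [x Ox ->] := pt_surj a.
pose e := mkseq (x : nat -> letter) N.+1.
have el : e \in level N by rewrite mem_level size_mkseq eqxx andbT; exact: Ox.
have [b /(describes_leaf H1 H2)[fl [v [C1 C2 _]]]] := HT e el.
rewrite (prepend_mkseq (x : nat -> letter) N.+1) in Ox *.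
exact: carries_agree C1 C2 Ox.
Qed.

(** ** Uniqueness of the normal form *)

Lemma describes_spread N h T : injective h -> describes h T ->
  (forall e, e \in level N -> edge_colour e = Red -> (true, e) \in labels T) ->
  spread N h.
Proof.
move=> hI H HT; split=> // x ex sx C.
have xl : x \in level N by rewrite mem_level ex sx eqxx.
have [fl [v [Cx _ /(_ isT)]]] := describes_leaf H H (HT x xl C).
by case: fl Cx => // Cx _; exists v.
Qed.

Lemma normal_form_unique N h1 h2 x L1 L2 R1 R2 D1 D2 :
  spread N h1 -> spread N h2 ->
  all (sized N) (labels (Expansion L1 R1 (RedLeaf x) D1)) ->
  all (sized N) (labels (Expansion L2 R2 (RedLeaf x) D2)) ->
  blue_normal L1 -> blue_normal L2 -> blue_normal R1 -> blue_normal R2 ->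
  red_normal D1 -> red_normal D2 ->
  describes h1 (Expansion L1 R1 (RedLeaf x) D1) ->
  describes h2 (Expansion L2 R2 (RedLeaf x) D2) ->
  L1 = L2 /\ R1 = R2 /\ D1 = D2.
Proof.
move=> s1 s2; rewrite /= !all_cat /=.
move=> /and4P[lL1 lR1 sx1 lD1] /and4P[lL2 lR2 sx2 lD2] nL1 nL2 nR1 nR2 nD1 nD2.
move=> [HL1 HR1 HU1 HD1] [HL2 HR2 HU2 HD2].
have [I1 _] := s1; have [I2 _] := s2.
have tL : tip_cell [:: eL] by [].
have tR : tip_cell [:: eR] by [].
have cD : red_cell [:: eD] by [].
have [cL _] := tL; have [cR _] := tR.
have P c c' b b' : is_edge [:: c] -> is_edge [:: c'] ->
    side [:: c] b = side [:: c'] b' -> end_pt [:: c] b = end_pt [:: c'] b'.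
  by move=> ec ec' E; apply/end_pt_eq.
have lf1 := allP lD1 _ (first_edge_label _); have lf2 := allP lD2 _ (first_edge_label _).
have ll1 := allP lD1 _ (last_edge_label _); have ll2 := allP lD2 _ (last_edge_label _).
have lL1' := allP lL1 _ (initial_label _); have lL2' := allP lL2 _ (initial_label _).
have lR1' := allP lR1 _ (initial_label _); have lR2' := allP lR2 _ (initial_label _).
have E1 : side x true = side (first_edge D1) false.
  apply: (sized_side I1 sx1 lf1).
  by rewrite (canonical_end_pt _ HU1) (first_edge_pt cD HD1); exact: P.
have E2 : side x true = side (first_edge D2) false.
  apply: (sized_side I2 sx2 lf2).
  by rewrite (canonical_end_pt _ HU2) (first_edge_pt cD HD2); exact: P.
have A1 : side x false = side (last_edge D1) true.
  apply: (sized_side I1 sx1 ll1).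
  by rewrite (canonical_end_pt _ HU1) (last_edge_pt cD HD1); exact: P.
have A2 : side x false = side (last_edge D2) true.
  apply: (sized_side I2 sx2 ll2).
  by rewrite (canonical_end_pt _ HU2) (last_edge_pt cD HD2); exact: P.
have F1 : side x true = side (initial L1).1 (initial L1).2.
  apply: (sized_side I1 sx1 lL1').
  by rewrite (canonical_end_pt _ HU1) (initial_pt cL HL1); exact: P.
have F2 : side x true = side (initial L2).1 (initial L2).2.
  apply: (sized_side I2 sx2 lL2').
  by rewrite (canonical_end_pt _ HU2) (initial_pt cL HL2); exact: P.
have B1 : side x false = side (initial R1).1 (initial R1).2.
  apply: (sized_side I1 sx1 lR1').
  by rewrite (canonical_end_pt _ HU1) (initial_pt cR HR1); exact: P.
have B2 : side x false = side (initial R2).1 (initial R2).2.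
  apply: (sized_side I2 sx2 lR2').
  by rewrite (canonical_end_pt _ HU2) (initial_pt cR HR2); exact: P.
have [Cf1 Cl1] := red_label_colour cD HD1; have [Cf2 Cl2] := red_label_colour cD HD2.
have U t1 t2 : is_edge (initial t1).1 && (size (initial t1).1 == N.+1) ->
    is_edge (initial t2).1 && (size (initial t2).1 == N.+1) ->
    edge_colour (initial t1).1 = Blue -> edge_colour (initial t2).1 = Blue ->
    side (initial t1).1 (initial t1).2 = side (initial t2).1 (initial t2).2 ->
    initial t1 = initial t2.
  move=> /andP[e1 /eqP z1] /andP[e2 /eqP z2] C1 C2 E.
  suff [Ea Eb] : (initial t1).1 = (initial t2).1 /\ (initial t1).2 = (initial t2).2.
    by rewrite [LHS]surjective_pairing Ea Eb -surjective_pairing.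
  by apply: blue_side_unique => //; rewrite z1 z2.
split; [|split].
- apply: ((normal_unique s1 s2 (blue_size L1).+1).2 _ _ _ _
    (ltnSn _) nL1 nL2 lL1 lL2 tL tL HL1 HL2).
  apply: U => //; [exact: initial_colour cL HL1 | exact: initial_colour cL HL2|].
  by rewrite -F1 -F2.
- apply: ((normal_unique s1 s2 (blue_size R1).+1).2 _ _ _ _
    (ltnSn _) nR1 nR2 lR1 lR2 tR tR HR1 HR2).
  apply: U => //; [exact: initial_colour cR HR1 | exact: initial_colour cR HR2|].
  by rewrite -B1 -B2.
- have [ef1 /eqP sf1] := andP lf1; have [ef2 /eqP sf2] := andP lf2.
  have [el1 /eqP sl1] := andP ll1; have [el2 /eqP sl2] := andP ll2.
  apply: ((normal_unique s1 s2 (red_size D1).+1).1 _ _ _ _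
    (ltnSn _) nD1 nD2 lD1 lD2 cD cD HD1 HD2).
  + by apply: (@red_side_unique _ _ false) => //; rewrite ?sf1 ?sf2 -?E1 -?E2.
  + by apply: (@red_side_unique _ _ true) => //; rewrite ?sl1 ?sl2 -?A1 -?A2.
Qed.

Section Generation.
Variables (G : set (Airplane -> Airplane)) (groupG : permutation_group G).
Variables alpha beta gamma delta epsilon : Airplane -> Airplane.
Hypotheses (Ga : G alpha) (Gb : G beta) (Gc : G gamma) (Gd : G delta) (Ge : G epsilon).
Hypotheses (Ea : acts_by alpha_rules alpha) (Eb : acts_by beta_rules beta)
  (Ec : acts_by gamma_rules gamma) (Ed : acts_by delta_rules delta)
  (Ee : acts_by epsilon_rules epsilon).

Lemma equi_linked T T' : equi T T' -> linked G T T'.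
Proof.
elim=> {T T'}.
- by move=> T; exact: linked_refl.
- by move=> T T' _; exact: linked_sym.
- by move=> T T' T'' _ H _; exact: linked_trans.
- by move=> *; exact: (link_alpha groupG Ga Ea).
- by move=> *; exact: (link_beta groupG Gb Eb).
- by move=> *; exact: (link_gamma groupG Gc Ec).
- by move=> *; exact: (link_delta groupG Gd Ed).
- by move=> *; exact: (link_epsilon groupG Ge Ee).
Qed.

Lemma group_bij g : G g -> exists2 g', G g' & cancel g g' /\ cancel g' g.
Proof. by case: groupG => _ _; exact. Qed.

Lemma subset_sized N T T' : {subset labels T' <= labels T} ->
  all (sized N) (labels T) -> all (sized N) (labels T').
Proof. by move=> S /allP H; apply/allP => l /S /H. Qed.

(** The expansion of a full level describes the identity when labelled at its own
    places, and the expansion of the image cells describes [f] with the same labels. *)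
Lemma T_A_generated f : T_A f -> G f.
Proof.
move=> /T_AP[hf [N fN]]; have [im [fim [M bar]]] := image_cells hf fN.
have [_ [f' [_ fK f'K]]] := hf.
have fI : injective f := can_inj fK.
have [T1 [D1 S1 V1]] : exists T, [/\ describes id T, all (sized N) (labels T) &
    forall v, v \in level N ->
      (if edge_colour v is Red then true else false, v) \in labels T].
  exists (build (fun v => v \in level N) id N).
  apply: (@build_describes (fun v => v \in level N) id N.+1 N id) => //.
  - by move=> e ee se; exists e; rewrite ?prefix_refl // mem_level ee se eqxx.
  - move=> p q; rewrite !mem_level => /andP[_ /eqP sp] /andP[_ /eqP sq].
    by rewrite prefixE sp -sq take_size => /eqP.
  - by move=> p; rewrite mem_level => /andP[ep _]; exact: canonical_id.
  - by move=> p; rewrite mem_level => /andP[_ /eqP].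
pose stop v := v \in [seq im e | e <- level N].
pose lab v := nth [::] (level N) (index v [seq im e | e <- level N]).
have labE v : stop v -> lab v \in level N /\ im (lab v) = v.
  move=> sv; have lt : index v [seq im e | e <- level N] < size (level N).
    by rewrite -(size_map im) index_mem.
  by split; [exact: mem_nth|rewrite -(nth_map _ [::]) // nth_index].
have imI e e' : e \in level N -> e' \in level N -> prefix (im e) (im e') -> e = e'.
  move=> el e'l /prefixP[s E].
  have /andP[ee' /eqP se'] : is_edge e' && (size e' == N.+1) by rewrite -mem_level.
  have /andP[_ /eqP se] : is_edge e && (size e == N.+1) by rewrite -mem_level.
  have [u gu] := generic_edge ee'; have [Ou _] := gu.
  have /canonicalP[ee iee C H] := fim e el.
  have /canonicalP[_ iee' C' H'] := fim e' e'l.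
  have Ou' : Omega (prepend e (prepend s u)).
    apply: (Omega_recolour iee) => //; rewrite -prepend_cat -E.
    exact: Omega_recolour Ou.
  have EE : prepend e' u = prepend e (prepend s u).
    apply: (pt_generic gu Ou'); apply: fI.
    by rewrite (H' u Ou) E prepend_cat -(H _ Ou').
  by rewrite -(mkseq_prepend0 e (prepend s u)) -EE se -se' mkseq_prepend0.
have anti p q : stop p -> stop q -> prefix p q -> p = q.
  by move=> /mapP[e el ->] /mapP[e' el' ->] /(imI e e' el el')->.
have labf p : stop p -> canonical_on f (lab p) p.
  by move=> /labE[/fim]; move=> + pE; rewrite pE.
have [D2 S2 V2] := @build_describes stop lab M.+1 N f
  (fun e ee se => let: ex_intro2 e1 e1l pe := bar e ee se in
     ex_intro2 _ _ (im e1) (map_f im e1l) pe) anti labf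
  (fun p sp => eqP (andP (etrans (esym (mem_level N _)) (labE p sp).1)).2) M erefl.
set T2 := build _ _ _ in D2 S2 V2.
have {}V2 v : v \in level N ->
    (if edge_colour v is Red then true else false, v) \in labels T2.
  move=> vl; have sv : stop (im v) by exact: map_f.
  have [ll li] := labE _ sv.
  have <- : lab (im v) = v by apply: imI => //; rewrite li prefix_refl.
  exact: V2.
(* Any red label will do as the common base point of the two normal forms. *)
pose x := first_edge (build_red stop lab M [:: eU]).
have x2 : (true, x) \in labels T2.
  by rewrite /= !mem_cat first_edge_label !orbT.
have xl : x \in level N by rewrite mem_level; exact: (allP S2 _ x2).
have Cx : edge_colour x = Red.
  by have [_ _ HU _] := D2; have [] := red_label_colour (w := [:: eU]) _ HU.
have x1 : (true, x) \in labels T1 by have := V1 x xl; rewrite Cx.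
have [L1 [R1 [W1 [nL1 nR1 nW1
  /equi_linked[[sub1 [g1 Gg1 H1]] [sub1' _]]]]]] := normal_form x1.
have [L2 [R2 [W2 [nL2 nR2 nW2
  /equi_linked[[sub2 [g2 Gg2 H2]] [sub2' _]]]]]] := normal_form x2.
have {}H1 := H1 _ D1; have {}H2 := H2 _ D2.
have [g1' Gg1' [g1K _]] := group_bij Gg1; have [g2' Gg2' [g2K _]] := group_bij Gg2.
have s1 : spread N (g1 \o id).
  apply: describes_spread H1 _; first exact: can_inj g1K.
  by move=> e el C; apply: sub1'; have := V1 e el; rewrite C.
have s2 : spread N (g2 \o f).
  apply: describes_spread H2 _; first exact: inj_comp (can_inj g2K) fI.
  by move=> e el C; apply: sub2'; have := V2 e el; rewrite C.
have [EL [ER EW]] := normal_form_unique s1 s2 (subset_sized sub1 S1)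
  (subset_sized sub2 S2) nL1 nL2 nR1 nR2 nW1 nW2 H1 H2.
rewrite -EL -ER -EW in H2.
have E : g1 \o id = g2 \o f.
  apply: (describes_inj (N := N) H1 H2) => e el; eexists.
  exact/sub1'/(V1 e el).
have -> : f = g2' \o g1.
  by apply/funext => a; rewrite /= -[g1 a]/((g1 \o id) a) E /= g2K.
by case: groupG => _ + _; apply.
Qed.

End Generation.

(* [unique P x] states that [x] is the only map satisfying [P]: the rules
   describe the five elements completely. *)
Theorem theorem5p2 :
  exists alpha beta gamma delta epsilon : Airplane -> Airplane,
    [/\ unique (acts_by alpha_rules) alpha,
        unique (acts_by beta_rules) beta,
        unique (acts_by gamma_rules) gamma,
        unique (acts_by delta_rules) delta &
        unique (acts_by epsilon_rules) epsilon] /\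
    T_A = generated_group [set alpha; beta; gamma; delta; epsilon].
Proof.
have [alpha [Ua Ta]] := acts_by_exists wf_alpha.
have [beta [Ub Tb]] := acts_by_exists wf_beta.
have [gamma [Uc Tc]] := acts_by_exists wf_gamma.
have [delta [Ud Td]] := acts_by_exists wf_delta.
have [epsilon [Ue Te]] := acts_by_exists wf_epsilon.
exists alpha, beta, gamma, delta, epsilon; split=> //.
apply/seteqP; split=> f Tf.
  move=> G [groupG SG].
  by apply: (T_A_generated groupG _ _ _ _ _ Ua.1 Ub.1 Uc.1 Ud.1 Ue.1 Tf);
    apply: SG; rewrite /=; tauto.
by apply: Tf; split; [exact: T_A_group | move=> g [[[[]|]|]|]->].
Qed.
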